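(* Let $n\ge1$, let $\Gamma\subset\mathbf{E}(n+1)$ be a crystallographic group with lattice $\mathcal{L}$ and point group $\mathbf{J}$, let $y_0>0$, and let $\widetilde{\mathbf{J}}$ be the point group of the symmetry group $\widetilde\Gamma\le\mathbf{E}(n)$ of $\Pi_{y_0}(X_\Gamma)$. Then $\widetilde{\mathbf{J}}$ is a subgroup of $$\mathbf{J}_0=\{\alpha\in\mathbf{O}(n):\text{either }\alpha_+\in\mathbf{J}\text{ or }\alpha_-\in\mathbf{J}\}\le\mathbf{O}(n),$$ satisfying: (1) if $(0,y_0)\in\mathcal{L}$ then $\widetilde{\mathbf{J}}=\mathbf{J}_0$; (2) if $(0,y_0)\notin\mathcal{L}$ then $\widetilde{\mathbf{J}}=\{\alpha\in\mathbf{J}_0:\text{either }((v,0),\alpha_+)\in\Gamma\text{ or }((v,y_0),\alpha_-)\in\Gamma\text{ for some }v\in\mathbb{R}^n\}$. Moreover, for every $\alpha\in\widetilde{\mathbf{J}}$ and every $v_\alpha\in\mathbb{R}^n$ with $(v_\alpha,\alpha)\in\widetilde\Gamma$, we have either $v_\alpha=\mathcal{P}(w)$ for some $w\in\mathbb{R}^{n+1}$ with $(w,\alpha_+)\in\Gamma$, or $v_\alpha=\mathcal{P}(w)$ for some $w\in\mathbb{R}^{n+1}$ with $(w,\alpha_-)\in\Gamma$.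
   Context: Points of $\mathbb{R}^{n+1}$ are written $(x,y)$ with $x\in\mathbb{R}^n$, $y\in\mathbb{R}$; $\mathcal{P}(x,y)=x$. A lattice in $\mathbb{R}^m$ is the set of all integer combinations of $m$ linearly independent vectors. The Euclidean group $\mathbf{E}(m)=\mathbb{R}^m\ltimes\mathbf{O}(m)$ consists of pairs $(v,\delta)$ acting by $(v,\delta)\cdot z=v+\delta z$. A crystallographic group $\Gamma\le\mathbf{E}(n+1)$ with lattice $\mathcal{L}$ is a subgroup such that $\mathcal{L}=\{v:(v,\mathrm{Id}_{n+1})\in\Gamma\}$ is a lattice in $\mathbb{R}^{n+1}$. The point group of a subgroup $G$ of $\mathbf{E}(m)$ is $\{\delta\in\mathbf{O}(m):(v,\delta)\in G\text{ for some }v\in\mathbb{R}^m\}$ (the term is used even if $G$ is not crystallographic). For $\alpha\in\mathbf{O}(n)$, $\alpha_+(x,y)=(\alpha x,y)$ and $\alpha_-(x,y)=(\alpha x,-y)$. $X_\Gamma$ is the vector space of all $C^1$ functions $f:\mathbb{R}^{n+1}\to\mathbb{R}$ with $f(\gamma^{-1}\cdot(x,y))=f(x,y)$ for all $\gamma\in\Gamma$ and all $(x,y)$. $\Pi_{y_0}(f)(x)=\int_0^{y_0}f(x,y)\,dy$ for $x\in\mathbb{R}^n$, and $\Pi_{y_0}(X_\Gamma)=\{\Pi_{y_0}(f):f\in X_\Gamma\}$. The symmetry group $\widetilde\Gamma$ of $\Pi_{y_0}(X_\Gamma)$ is the group of all $\gamma\in\mathbf{E}(n)$ such that $g(\gamma^{-1}\cdot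 x)=g(x)$ for all $x\in\mathbb{R}^n$ and all $g\in\Pi_{y_0}(X_\Gamma)$. *)

(* Defs.v *)
From HB Require Import structures.
From mathcomp Require Import all_boot all_order all_algebra.
From mathcomp Require Import all_classical all_reals all_analysis.

Set Implicit Arguments.
Unset Strict Implicit.
Unset Printing Implicit Defensive.

Import Order.TTheory GRing.Theory Num.Theory.
Import numFieldNormedType.Exports.
Local Open Scope classical_set_scope.
Local Open Scope ring_scope.

Record orthogonal (R : realType) (m : nat) := Orthogonal {
  omx :> 'M[R]_m;
  _ : omx^T *m omx == 1%:M
}.

Notation "''O[' R ]_ m" := (orthogonal R m)
  (at level 8, m at level 2, format "''O[' R ]_ m") : type_scope.

Section OrthogonalGroup.
Variables (R : realType) (m : nat).
Implicit Types a b c : 'O[R]_m.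

HB.instance Definition _ := [isSub for @omx R m].
HB.instance Definition _ := [Choice of 'O[R]_m by <:].

Lemma omxTM a : (omx a)^T *m omx a = 1%:M.
Proof. exact/eqP/(valP a). Qed.

Lemma omxMT a : omx a *m (omx a)^T = 1%:M.
Proof. exact/mulmx1C/omxTM. Qed.

Lemma omul_subproof a b :
  (omx a *m omx b)^T *m (omx a *m omx b) == 1%:M.
Proof. by rewrite trmx_mul -mulmxA (mulmxA _^T (omx a)) omxTM mul1mx omxTM. Qed.

Lemma oone_subproof : (1%:M : 'M[R]_m)^T *m 1%:M == 1%:M.
Proof. by rewrite trmx1 mulmx1. Qed.

Lemma oinv_subproof a : (omx a)^T^T *m (omx a)^T == 1%:M.
Proof. by rewrite trmxK omxMT. Qed.

Definition omul a b := Orthogonal (omul_subproof a b).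
Definition oone := Orthogonal oone_subproof.
Definition oinv a := Orthogonal (oinv_subproof a).

Lemma omulA : associative omul.
Proof. by move=> a b c; apply: val_inj; rewrite /= mulmxA. Qed.

Lemma omul1 : left_id oone omul.
Proof. by move=> a; apply: val_inj; rewrite /= mul1mx. Qed.

Lemma omulr1 : right_id oone omul.
Proof. by move=> a; apply: val_inj; rewrite /= mulmx1. Qed.

Lemma omulV : left_inverse oone oinv omul.
Proof. by move=> a; apply: val_inj; rewrite /= omxTM. Qed.

Lemma omulrV : right_inverse oone oinv omul.
Proof. by move=> a; apply: val_inj; rewrite /= omxMT. Qed.

HB.instance Definition _ :=
  isGroup.Build 'O[R]_m omulA omul1 omulr1 omulV omulrV.

End OrthogonalGroup.

Record euclid (R : realType) (m : nat) := Euclid {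
  evec : 'cV[R]_m;
  elin : 'O[R]_m
}.

Notation "''E[' R ]_ m" := (euclid R m)
  (at level 8, m at level 2, format "''E[' R ]_ m") : type_scope.

Definition eact (R : realType) (m : nat) (g : 'E[R]_m) (z : 'cV[R]_m) :
  'cV[R]_m := evec g + elin g *m z.

Section EuclideanGroup.
Variables (R : realType) (m : nat).
Implicit Types g h k : 'E[R]_m.

Let pair_of_euclid g := (evec g, elin g).
Let euclid_of_pair (p : 'cV[R]_m * 'O[R]_m) := Euclid p.1 p.2.
Let pair_of_euclidK : cancel pair_of_euclid euclid_of_pair.
Proof. by case. Qed.
HB.instance Definition _ := Choice.copy 'E[R]_m (can_type pair_of_euclidK).

Definition emul g h := Euclid (eact g (evec h)) (elin g * elin h)%g.
Definition eone : 'E[R]_m := Euclid 0 1%g.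
Definition einv g := Euclid (- ((elin g)^-1%g *m evec g)) (elin g)^-1%g.

Lemma emulA : associative emul.
Proof.
move=> [v a] [w b] [u c]; congr Euclid; last exact: mulgA.
by rewrite /eact /= mulmxDr mulmxA addrA.
Qed.

Lemma emul1 : left_id eone emul.
Proof.
by move=> [v a]; congr Euclid; rewrite ?mul1g// /eact/= mul1mx add0r.
Qed.

Lemma emulr1 : right_id eone emul.
Proof.
by move=> [v a]; congr Euclid; rewrite ?mulg1// /eact/= mulmx0 addr0.
Qed.

Lemma emulV : left_inverse eone einv emul.
Proof.
by move=> [v a]; congr Euclid; rewrite ?mulVg// /eact/= addNr.
Qed.

Lemma emulrV : right_inverse eone einv emul.
Proof.
move=> [v a]; congr Euclid; rewrite ?mulgV// /eact/=.
by rewrite mulmxN mulmxA omxMT mul1mx subrr.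
Qed.

HB.instance Definition _ :=
  isGroup.Build 'E[R]_m emulA emul1 emulr1 emulV emulrV.

Lemma eactM g h z : eact (g * h)%g z = eact g (eact h z).
Proof. by rewrite /eact /= /eact mulmxDr mulmxA addrA. Qed.

End EuclideanGroup.

Definition subgroup (G : groupType) (S : set G) : Prop :=
  group_closed (mem S).

Definition point_group (R : realType) (m : nat) (G : set 'E[R]_m) :
  set 'O[R]_m := [set d | exists v, G (Euclid v d)].

Definition is_lattice (R : realType) (m : nat) (L : set 'cV[R]_m) : Prop :=
  exists2 b : m.-tuple 'cV[R]_m, free b &
    L = [set v | exists c : 'I_m -> int, v = \sum_(i < m) tnth b i *~ c i].

Definition translations (R : realType) (m : nat) (G : set 'E[R]_m) :
  set 'cV[R]_m := [set v | G (Euclid v 1%g)].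

Definition crystallographic (R : realType) (m : nat) (G : set 'E[R]_m) : Prop :=
  subgroup G /\ is_lattice (translations G).

Definition pt (R : realType) (n : nat) (x : 'cV[R]_n) (y : R) :
  'cV[R]_(n + 1) := col_mx x y%:M.

Definition projx (R : realType) (n : nat) (w : 'cV[R]_(n + 1)) : 'cV[R]_n :=
  usubmx w.

Section Extensions.
Variables (R : realType) (n : nat) (a : 'O[R]_n).

Lemma oplus_subproof (A := block_mx (omx a) 0 0 (1%:M : 'M[R]_1)) :
  A^T *m A == 1%:M.
Proof.
rewrite tr_block_mx mulmx_block !trmx0 trmx1 omxTM !(mulmx0, mul0mx, mulmx1).
by rewrite !(addr0, add0r) -scalar_mx_block.
Qed.

Lemma ominus_subproof (A := block_mx (omx a) 0 0 ((-1)%:M : 'M[R]_1)) :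
  A^T *m A == 1%:M.
Proof.
rewrite tr_block_mx mulmx_block !trmx0 tr_scalar_mx omxTM.
rewrite !(mulmx0, mul0mx) -scalar_mxM mulrNN mulr1.
by rewrite !(addr0, add0r) -scalar_mx_block.
Qed.

Definition oplus : 'O[R]_(n + 1) := Orthogonal oplus_subproof.
Definition ominus : 'O[R]_(n + 1) := Orthogonal ominus_subproof.

Lemma oplusE x y : omx oplus *m pt x y = pt (omx a *m x) y.
Proof.
by rewrite /= mul_block_col !mul0mx addr0 add0r mul1mx.
Qed.

Lemma ominusE x y : omx ominus *m pt x y = pt (omx a *m x) (- y).
Proof.
by rewrite /= mul_block_col !mul0mx addr0 add0r -scalar_mxM mulN1r.
Qed.

End Extensions.

(* Continuity of z |-> 'd f z is required pointwise in the direction v; for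
   linear forms on a finite-dimensional space this is continuity in operator
   norm. *)
Definition C1 (R : realType) (m : nat) (f : 'cV[R]_m -> R) : Prop :=
  (forall z, differentiable f z) /\ (forall v, continuous (fun z => 'd f z v)).

Definition invariant_functions (R : realType) (m : nat) (G : set 'E[R]_m) :
  set ('cV[R]_m -> R) :=
  [set f | C1 f /\ forall g, G g -> forall z, f (eact g^-1%g z) = f z].

Definition projection (R : realType) (n : nat) (y0 : R)
    (f : 'cV[R]_(n + 1) -> R) : 'cV[R]_n -> R :=
  fun x => \int[lebesgue_measure]_(y in `[0, y0]) f (pt x y).

Definition symmetry_group (R : realType) (n : nat) (S : set ('cV[R]_n -> R)) :
  set 'E[R]_n :=
  [set g | forall f, S f -> forall x, f (eact g^-1%g x) = f x].

Definition projected_symmetries (R : realType) (n : nat) (y0 : R)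
    (G : set 'E[R]_(n + 1)) : set 'E[R]_n :=
  symmetry_group (projection y0 @` invariant_functions G).

Definition J0 (R : realType) (n : nat) (J : set 'O[R]_(n + 1)) : set 'O[R]_n :=
  [set a | J (oplus a) \/ J (ominus a)].

(* Main.v *)
Require Import Defs.
From HB Require Import structures.
From mathcomp Require Import all_boot all_order all_algebra.
From mathcomp Require Import all_classical all_reals all_analysis.
From mathcomp Require Import zify ring lra.

(** Let G be the crystallographic group, y0 the length of the segments, and
    call fibre over x the vertical line through x. The isometry elift e b g of
    the total space covers the isometry g = (v, alpha) of the base; its linear
    part is alpha_+ or alpha_- according to e and its translation part (v, b).

    If elift e b g is in G, an invariant function takes the same values on
    the fibres over x and over g x, up to y |-> b + y or y |-> b - y. So g is
    a projected symmetry as soon as this map preserves the segment [0, y0]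
    (translation with b = 0, reflection with b = y0), and for every b if the
    invariant functions have period y0 in y. These are the easy inclusions:
    projected_symmetry_plus, projected_symmetry_minus and
    projected_symmetry_periodic.

    The converse uses test functions. Since G is discrete, a bump near a point
    z can be transported along the orbit of z to an invariant C^1 function
    (localize). Let g be a projected symmetry and z = (x, y0 / 2). A small
    nonnegative bump has positive projection at x, hence at g x, so some
    element of G maps z into the segment over g x. For fixed x this may be
    an accident, but only finitely many group elements are relevant,
    and a generic x satisfies only those equations that hold identically
    (generic_orbit). An element of G that sends (x, q) over g x for all x
    covers g, because an orthogonal matrix with an orthogonal block is block
    diagonal. This gives projected_symmetry_lift: every projected symmetry g
    is covered by some elift e b g in G.

    If (0, y0) is not a lattice vector, the height b matters. Take a bump
    around (x, q), with q an endpoint of [0, y0], that is odd in y - q. Along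
    fibres it has a primitive supported near the orbit, so its projection only
    depends on what happens at the two endpoints, and a comparison of signs at
    x and g x shows: G contains elift false 0 g or elift true y0 g, or else
    the reflection y |-> 2 q - y of the fibres (endpoint_reflection). In the
    latter case for both q, the vertical translations in G contain 2 y0,
    and also 2 b for any b occurring over g. They form a discrete subgroup of
    the line that does not contain y0, so b or b - y0 belongs to it, and this
    corrects b to 0 or y0 (projected_symmetry_endpoints). *)

Set Implicit Arguments.
Unset Strict Implicit.
Unset Printing Implicit Defensive.

Import Order.TTheory GRing.Theory Num.Theory.
Import numFieldNormedType.Exports.
Local Open Scope classical_set_scope.
Local Open Scope ring_scope.

(** * Squared Euclidean length *)

Definition sqn (R : realType) (m : nat) (z : 'cV[R]_m) : R :=
  \sum_i z i 0 ^+ 2.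

Section SquaredNorm.
Variables (R : realType) (m : nat).
Implicit Types z w : 'cV[R]_m.

Lemma sqn_ge0 z : 0 <= sqn z.
Proof. by apply: sumr_ge0 => i _; exact: sqr_ge0. Qed.

Lemma sqn_eq0 z : (sqn z == 0) = (z == 0).
Proof.
apply/eqP/eqP => [z0|->]; last first.
  by rewrite /sqn big1 // => i _; rewrite mxE expr0n.
apply/matrixP => i j; rewrite (ord1 j) mxE; apply/eqP.
rewrite -sqrf_eq0; apply/eqP.
exact: (psumr_eq0P (fun k _ => sqr_ge0 (z k 0)) z0).
Qed.

Lemma sqn0 : sqn (0 : 'cV[R]_m) = 0.
Proof. by apply/eqP; rewrite sqn_eq0. Qed.

Lemma sqnN z : sqn (- z) = sqn z.
Proof. by apply: eq_bigr => i _; rewrite mxE sqrrN. Qed.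

Lemma sqnBC z w : sqn (z - w) = sqn (w - z).
Proof. by rewrite -sqnN opprB. Qed.

(** The square root is avoided throughout: this weak triangle inequality for
    squared lengths replaces the triangle inequality, at the price of factors 2
    in all later constants. *)
Lemma sqnD_le z w : sqn (z + w) <= 2 * sqn z + 2 * sqn w.
Proof.
rewrite /sqn !mulr_sumr -big_split /=; apply: ler_sum => i _; rewrite mxE.
by have := sqr_ge0 (z i 0 - w i 0); lra.
Qed.

Lemma sqnB_le z w u : sqn (z - u) <= 2 * sqn (z - w) + 2 * sqn (w - u).
Proof. by rewrite -(subrKA w z (- u)) sqnD_le. Qed.

(** From t <= 1 + t^2; this controls coordinates without square roots. *)
Lemma coord_le_sqn z i : `|z i 0| <= 1 + sqn z.
Proof.
apply: (@le_trans _ _ (1 + z i 0 ^+ 2)).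
  by rewrite -[z i 0 ^+ 2]real_normK ?num_real//; nra.
by rewrite lerD2l /sqn (bigD1 i) //= lerDl sumr_ge0 // => j _; exact: sqr_ge0.
Qed.

Lemma sqn_le_coord z : (forall i, `|z i 0| <= 1) -> sqn z <= m%:R.
Proof.
move=> z1; apply: (@le_trans _ _ (\sum_(i < m) (1 : R))); last first.
  by rewrite sumr_const card_ord.
apply: ler_sum => i _; rewrite -[z i 0 ^+ 2]real_normK ?num_real//.
by have := z1 i; have := normr_ge0 (z i 0); nra.
Qed.

Lemma sqnE z : sqn z = (z^T *m z) 0 0.
Proof. by rewrite mxE; apply: eq_bigr => i _; rewrite mxE expr2. Qed.

Lemma sqn_orthogonal (d : 'O[R]_m) z : sqn (d *m z) = sqn z.
Proof. by rewrite !sqnE trmx_mul mulmxA -(mulmxA _ _ (omx d)) omxTM mulmx1. Qed.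

Lemma eactB (g : 'E[R]_m) z w : eact g z - eact g w = elin g *m (z - w).
Proof. by rewrite /eact mulmxBr opprD addrACA subrr add0r. Qed.

Lemma sqn_eactB (g : 'E[R]_m) z w : sqn (eact g z - eact g w) = sqn (z - w).
Proof. by rewrite eactB sqn_orthogonal. Qed.

Lemma eact1 z : eact 1%g z = z.
Proof. by rewrite /eact /= mul1mx add0r. Qed.

Lemma eactK (g : 'E[R]_m) : cancel (eact g) (eact g^-1%g).
Proof. by move=> z; rewrite -eactM mulVg eact1. Qed.

Lemma eactVK (g : 'E[R]_m) : cancel (eact g^-1%g) (eact g).
Proof. by move=> z; rewrite -eactM mulgV eact1. Qed.

Lemma sqn_eactV (g : 'E[R]_m) z w :
  sqn (eact g z - w) = sqn (z - eact g^-1%g w).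
Proof. by rewrite -[RHS](sqn_eactB g) eactVK. Qed.

Lemma sqn_eact_sub (g : 'E[R]_m) z w :
  sqn (eact g z - w) = sqn (eact g^-1%g w - z).
Proof. by rewrite sqn_eactV sqnBC. Qed.

Lemma sqn_evec_le (g : 'E[R]_m) z :
  sqn (evec g) <= 2 * sqn (eact g z) + 2 * sqn z.
Proof.
have -> : evec g = eact g z - elin g *m z by rewrite /eact addrK.
by apply: le_trans (sqnD_le _ _) _; rewrite sqnN sqn_orthogonal.
Qed.

Lemma sqn_eact_le (g : 'E[R]_m) z :
  sqn (eact g z) <= 2 * sqn (evec g) + 2 * sqn z.
Proof. by apply: le_trans (sqnD_le _ _) _; rewrite sqn_orthogonal. Qed.

Lemma euclid_eq (g h : 'E[R]_m) :
  evec g = evec h -> omx (elin g) = omx (elin h) -> g = h.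
Proof. by case: g h => [v a] [w b] /= -> /val_inj->. Qed.

End SquaredNorm.

(** * Points of the total space *)

Definition ycoord (R : realType) (n : nat) (z : 'cV[R]_(n + 1)) : R :=
  dsubmx z 0 0.

Section Points.
Variables (R : realType) (n : nat).
Implicit Types (x : 'cV[R]_n) (y : R) (z : 'cV[R]_(n + 1)).

Lemma pt_eta z : z = pt (projx z) (ycoord z).
Proof. by rewrite /pt -mx11_scalar vsubmxK. Qed.

Lemma projx_pt x y : projx (pt x y) = x.
Proof. exact: col_mxKu. Qed.

Lemma ycoord_pt x y : ycoord (pt x y) = y.
Proof. by rewrite /ycoord /pt col_mxKd mxE eqxx mulr1n. Qed.

Lemma ptD x y x' y' : pt x y + pt x' y' = pt (x + x') (y + y').
Proof. by rewrite /pt add_col_mx -raddfD. Qed.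

Lemma ptN x y : - pt x y = pt (- x) (- y).
Proof. by rewrite /pt opp_col_mx -raddfN. Qed.

Lemma ptB x y x' y' : pt x y - pt x' y' = pt (x - x') (y - y').
Proof. by rewrite ptN ptD. Qed.

Lemma pt_inj x y x' y' : pt x y = pt x' y' -> x = x' /\ y = y'.
Proof.
move=> e; split; first by rewrite -(projx_pt x y) e projx_pt.
by rewrite -(ycoord_pt x y) e ycoord_pt.
Qed.

Lemma sqn_pt x y : sqn (pt x y) = sqn x + y ^+ 2.
Proof.
rewrite /sqn big_split_ord /= big_ord1; congr (_ + _ ^+ 2).
  by apply: eq_bigr => i _; rewrite col_mxEu.
by rewrite col_mxEd mxE eqxx.
Qed.

End Points.

(** * Isometries that cover an isometry of the base *)

Definition oext (R : realType) (n : nat) (e : bool) (a : 'O[R]_n) :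
  'O[R]_(n + 1) := if e then ominus a else oplus a.

(** The isometries of R^(n+1) that cover an isometry g of R^n: over g, the
    fibre coordinate y becomes b + y or b - y according to the sign e. Treating
    both signs at once makes composition and inversion uniform. *)
Definition elift (R : realType) (n : nat) (e : bool) (b : R) (g : 'E[R]_n) :
  'E[R]_(n + 1) := Euclid (pt (evec g) b) (oext e (elin g)).

Section Lifts.
Variables (R : realType) (n : nat).
Implicit Types (g h : 'E[R]_n) (b c : R) (e : bool).

Lemma omx_elift e b g :
  omx (elin (elift e b g)) = block_mx (omx (elin g)) 0 0 ((-1) ^+ e)%:M.
Proof. by case: e => //=. Qed.

Lemma eact_elift e b g x y :
  eact (elift e b g) (pt x y) = pt (eact g x) (b + (-1) ^+ e * y).
Proof.
rewrite /eact omx_elift /elift /= /pt mul_block_col !mul0mx addr0 add0r.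
rewrite -scalar_mxM.
exact: ptD.
Qed.

Lemma elift1 : elift false 0 1%g = 1%g :> 'E[R]_(n + 1).
Proof.
apply: euclid_eq; rewrite ?omx_elift /=; last by rewrite -scalar_mx_block.
by rewrite /pt raddf0 col_mx0.
Qed.

Lemma eliftM e b g e' b' g' :
  (elift e b g * elift e' b' g')%g =
  elift (e (+) e') (b + (-1) ^+ e * b') (g * g')%g.
Proof.
apply: euclid_eq; first by rewrite [LHS]eact_elift.
rewrite [LHS](_ : _ =
  omx (elin (elift e b g)) *m omx (elin (elift e' b' g'))) //.
rewrite !omx_elift mulmx_block !(mulmx0, mul0mx, addr0, add0r) -scalar_mxM.
by rewrite signr_addb.
Qed.

Lemma eliftV e b g : ((elift e b g)^-1)%g = elift e (- ((-1) ^+ e * b)) g^-1%g.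
Proof.
apply: mulg1_eq; rewrite eliftM addbb mulgV.
by rewrite mulrN mulrA -signr_addb addbb mul1r subrr elift1.
Qed.

Lemma projx_eact (k : 'E[R]_(n + 1)) x q :
  projx (eact k (pt x q)) = ulsubmx (omx (elin k)) *m x +
    (projx (evec k) + q *: ursubmx (omx (elin k))).
Proof.
rewrite /projx /eact raddfD /= -[omx (elin k) in LHS]submxK /pt.
rewrite mul_block_col col_mxKu.
by rewrite mul_mx_scalar [RHS]addrC addrAC addrA.
Qed.

Lemma mulmx_trmx_eq0 p m (A : 'M[R]_(p, m)) : A *m A^T = 0 -> A = 0.
Proof.
move=> A0; apply/matrixP => i j; rewrite mxE; apply/eqP; rewrite -sqrf_eq0.
have /matrixP/(_ i i) := A0; rewrite !mxE => A0i.
have F0 k : true -> 0 <= A i k * A^T k i by rewrite mxE -expr2 sqr_ge0.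
have /(_ j isT) := psumr_eq0P F0 A0i.
by rewrite mxE -expr2 => ->.
Qed.

(** An orthogonal matrix whose upper left block is already orthogonal has zero
    off-diagonal blocks, because its rows and columns are unit vectors; the
    remaining entry is then 1 or -1. *)
Lemma eq_elift (k : 'E[R]_(n + 1)) g q :
  ulsubmx (omx (elin k)) = elin g ->
  projx (evec k) + q *: ursubmx (omx (elin k)) = evec g ->
  exists e b, k = elift e b g.
Proof.
case: k => w d /= dul wv.
have := omxMT d; have := omxTM d; rewrite -(submxK (omx d)).
rewrite dul tr_block_mx !mulmx_block (scalar_mx_block n 1 1).
move=> /eq_block_mx[] + _ _ _ /eq_block_mx[] + _ _ drr.
rewrite omxTM omxMT -[X in _ = X]addr0 => /addrI dl0.
rewrite -[X in _ = X]addr0 => /addrI dr0.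
have {}dr0 := mulmx_trmx_eq0 dr0.
have {}dl0 : dlsubmx (omx d) = 0.
  by apply: trmx_inj; rewrite trmx0; apply: mulmx_trmx_eq0; rewrite trmxK.
rewrite dr0 scaler0 addr0 in wv.
move: drr; rewrite dl0 mul0mx add0r => drr.
pose c := drsubmx (omx d) 0 0.
have cE : drsubmx (omx d) = c%:M by rewrite [LHS]mx11_scalar.
have c2 : c ^+ 2 == 1.
  move: drr; rewrite cE tr_scalar_mx -scalar_mxM => /matrixP/(_ 0 0).
  by rewrite !mxE !mulr1n expr2 => ->.
have [e ce] : exists e : bool, c = (-1) ^+ e.
  by move: c2; rewrite sqrf_eq1 => /orP[]/eqP->; [exists false|exists true].
exists e, (ycoord w); apply: euclid_eq => /=; first by rewrite -wv -pt_eta.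
rewrite [RHS](omx_elift e (ycoord w) g) -ce -cE -dul -{1}dr0 -dl0.
by rewrite submxK.
Qed.

End Lifts.

(** * Discreteness of crystallographic groups *)

Lemma subgroupP (G : groupType) (S : set G) : subgroup S <->
  [/\ S 1%g, (forall x y, S x -> S y -> S (x * y)%g) &
      forall x, S x -> S x^-1%g].
Proof.
split=> [S_|[S1 SM SV]].
  split; first by case: S_ => + _; rewrite inE.
    move=> x y xS yS.
    by have := group_closedM S_ (x:=x) (y:=y); rewrite !inE; exact.
  by move=> x xS; have := group_closedV S_ (x:=x); rewrite !inE; exact.
split; first by rewrite inE.
by move=> x y; rewrite !inE => xS /SV; exact: SM.
Qed.

Definition int_box (R : realType) p q (K : R) : set 'M[R]_(p, q) :=
  [set X | (exists Z : 'M[int]_(p, q), X = map_mx intr Z) /\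
           forall i j, `|X i j| <= K].

Lemma finite_int_box (R : realType) p q (K : R) : finite_set (@int_box R p q K).
Proof.
pose k := Num.bound `|K|.
pose f (Y : 'M['I_(k.*2)]_(p, q)) : 'M[R]_(p, q) :=
  map_mx (fun i : 'I_ _ => i%:R - k%:R) Y.
have fin : finite_set (range f) by apply: finite_image; exact: finite_finset.
apply: sub_finite_set fin => _ [[Z ->] ZK].
have Zk i j : `|Z i j| < k%:Z.
  rewrite -(ltr_int R) intr_norm; have := ZK i j; rewrite mxE => /le_lt_trans.
  by apply; apply: le_lt_trans (ler_norm K) _; exact: archi_boundP.
have Zk2 i j : (`|(Z i j + k%:Z)%R|%N < k.*2)%N.
  by have := Zk i j; rewrite -addnn; lia.
exists (\matrix_(i, j) Ordinal (Zk2 i j)) => //.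
apply/matrixP => i j; rewrite !mxE /=.
apply/eqP; rewrite subr_eq; apply/eqP.
rewrite pmulrn gez0_abs ?rmorphD//=.
by have := Zk i j; lia.
Qed.

(** The sum of the absolute values of all entries bounds the operator norm for
    the maximum norm on entries. *)
Definition mx_mass (R : realType) p q (P : 'M[R]_(p, q)) : R :=
  \sum_i \sum_j `|P i j|.

Lemma mulmx_entry_le (R : realType) p q r (P : 'M[R]_(p, q)) (X : 'M[R]_(q, r))
    (K : R) : (forall i j, `|X i j| <= K) ->
  forall i j, `|(P *m X) i j| <= mx_mass P * K.
Proof.
move=> XK i j; have [l _|q0] := pickP 'I_q; last first.
  rewrite mxE big1 ?normr0; last by move=> l; have := q0 l.
  rewrite /mx_mass big1 ?mul0r// => ? _; rewrite big1// => l.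
  by have := q0 l.
have K0 : 0 <= K by exact: le_trans (XK l j).
rewrite mxE; apply: le_trans (ler_norm_sum _ _ _) _.
rewrite /mx_mass (bigD1 i)//= mulrDl -[leLHS]addr0; apply: lerD.
  rewrite mulr_suml; apply: ler_sum => s _; rewrite normrM.
  exact: ler_wpM2l.
by rewrite mulr_ge0// sumr_ge0// => ? _; exact: sumr_ge0.
Qed.

Lemma orthogonal_entry_le (R : realType) m (d : 'O[R]_m) i j :
  `|omx d i j| <= 1 + m%:R.
Proof.
have -> : omx d i j = (omx d *m delta_mx j (0 : 'I_1)) i 0.
  by rewrite -colE mxE.
apply: le_trans (coord_le_sqn _ _) _; rewrite lerD2l sqn_orthogonal.
apply: sqn_le_coord => k; rewrite mxE eqxx andbT.
by case: (k == j); rewrite ?normr1 ?normr0.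
Qed.

Section Discreteness.
Variables (R : realType) (m : nat).

Lemma lattice_basis (L : set 'cV[R]_m) : is_lattice L ->
  exists2 B : 'M[R]_m, B \in unitmx &
    L = [set v | exists c : 'cV[int]_m, v = B *m map_mx intr c].
Proof.
move=> [b bfree ->]; exists (\matrix_(i, j) tnth b j i 0).
  rewrite -unitmx_tr -row_free_unit; apply: inj_row_free => v v0.
  apply/rowP => j; rewrite mxE.
  have /freeP/(_ (fun j => v 0 j)) := bfree; apply.
  move/matrixP: v0 => v0; apply/matrixP => i l; rewrite (ord1 l) summxE mxE.
  have := v0 0 i; rewrite !mxE => v0i; rewrite -[RHS]v0i; apply: eq_bigr => k _.
  by rewrite !mxE (tnth_nth 0).
apply/seteqP; split=> v [c ->].
  exists (\col_i c i); apply/matrixP => i l; rewrite (ord1 l) summxE mxE.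
  by apply: eq_bigr => k _; rewrite -scaler_int !mxE mulrC.
exists (fun i => c i 0); apply/matrixP => i l; rewrite (ord1 l) summxE mxE.
by apply: eq_bigr => k _; rewrite -scaler_int !mxE mulrC.
Qed.

Lemma finite_lattice_ball (L : set 'cV[R]_m) (M : R) : is_lattice L ->
  finite_set [set v | L v /\ sqn v <= M].
Proof.
move=> /lattice_basis[B Bu ->].
have fin := finite_image (mulmx B)
  (@finite_int_box R m 1 (mx_mass (invmx B) * (1 + M))).
apply: sub_finite_set fin => _ [[c ->] cM].
exists (map_mx intr c) => //; split; first by exists c.
rewrite -[map_mx intr c](mulKmx Bu); apply: mulmx_entry_le => i j.
by rewrite (ord1 j); apply: le_trans (coord_le_sqn _ _) _; rewrite lerD2l.
Qed.

Variable G : set 'E[R]_m.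
Hypothesis Gcryst : crystallographic G.

(** The point group preserves the lattice, so in a lattice basis its elements
    become integer matrices. Orthogonal matrices have bounded entries, hence so
    do these integer matrices, and there are finitely many of them. *)
Lemma finite_point_group : finite_set (point_group G).
Proof.
have [/subgroupP[G1 GM GV]] := Gcryst.
move=> /lattice_basis[B Bu LE].
have LB j : translations G (col j B).
  rewrite LE; exists (delta_mx j 0); rewrite map_delta_mx colE; congr (_ *m _).
have Ld d v : point_group G d -> translations G v -> translations G (d *m v).
  move=> [w Gwd] Gv; have := GM _ _ (GM _ _ Gwd Gv) (GV _ Gwd).
  rewrite /translations /=; congr G; apply: euclid_eq => /=.
    rewrite eactM /eact /= mul1mx mulmxDr mulmxN mulmxA omxMT mul1mx.
    by rewrite addrC subrK.
  by rewrite mulmx1 omxMT.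
pose K : R := mx_mass B^T * (mx_mass (invmx B) * (1 + m%:R)).
have fin : finite_set [set B *m Z *m invmx B | Z in @int_box R m m K].
  by apply: finite_image; exact: finite_int_box.
have : finite_set
    (@omx R m @^-1` [set B *m Z *m invmx B | Z in @int_box R m m K]).
  by apply: finite_preimage fin => ? ? _ _; exact: val_inj.
apply: sub_finite_set => d Jd.
have dB j : exists c : 'cV[int]_m, omx d *m col j B = B *m map_mx intr c.
  by have := Ld _ _ Jd (LB j); rewrite LE.
have [c cE] := choice dB.
pose Z : 'M[R]_m := map_mx intr (\matrix_(i, j) c j i 0).
have dBE : omx d *m B = B *m Z.
  apply/matrixP => i j; have /matrixP/(_ i 0) := cE j.
  rewrite colE mulmxA -colE mxE => ->; rewrite !mxE.
  by apply: eq_bigr => k _; rewrite !mxE.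
have ZE : Z = invmx B *m omx d *m B by rewrite -mulmxA dBE mulKmx.
exists Z; last by rewrite -dBE mulmxK.
split; first by eexists.
move=> i j; have -> : Z i j = (B^T *m (invmx B *m omx d)^T) j i.
  by rewrite -trmx_mul [RHS]mxE -ZE.
apply: mulmx_entry_le => k l; rewrite mxE.
by apply: mulmx_entry_le => ? ?; exact: orthogonal_entry_le.
Qed.

(** Two elements of the group with the same linear part differ by a lattice
    vector. Hence each of the finitely many linear parts occurs with finitely
    many bounded translation parts. *)
Lemma finite_euclid_ball (M : R) :
  finite_set [set g | G g /\ sqn (evec g) <= M].
Proof.
have [/subgroupP[G1 GM GV] Glat] := Gcryst.
have : finite_set (\bigcup_(d in point_group G)
    [set g | [/\ G g, elin g = d & sqn (evec g) <= M]]).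
  apply: (bigcup_finite finite_point_group) => d [w0 Gw0].
  have fin := finite_image (fun l => Euclid (l + w0) d)
    (finite_lattice_ball (2 * M + 2 * sqn w0) Glat).
  apply: sub_finite_set fin => -[w e] [/= Gw ed wM].
  exists (w - w0); last by rewrite subrK ed.
  split; last first.
    by apply: le_trans (sqnD_le _ _) _; rewrite sqnN lerD2r ler_pM2l.
  have := GM _ _ Gw (GV _ Gw0); rewrite /translations /=; congr G.
  apply: euclid_eq => /=; rewrite ed ?omxMT//.
  by rewrite /eact /= mulmxN mulmxA omxMT mul1mx.
apply: sub_finite_set => -[w d] [Gg gM].
by exists d => //; exists w.
Qed.

End Discreteness.

(** * Generic points *)

Definition moment (R : realType) n (t : R) : 'cV[R]_n := \col_i t ^+ i.+1.

Lemma exists_non_root (R : realType) (Q : {poly R}) : Q != 0 ->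
  exists t, [/\ 0 <= t, t <= 1 & Q.[t] != 0].
Proof.
move=> Q0; pose r : seq R := [seq k.+1%:R^-1 | k <- iota 0 (size Q)].
have [/(max_poly_roots Q0)|] := boolP (all (root Q) r).
  rewrite map_inj_uniq ?iota_uniq.
    by move=> /(_ isT); rewrite size_map size_iota ltnn.
  by move=> a b /invr_inj/eqP; rewrite eqr_nat eqSS => /eqP.
move=> /allPn[_ /mapP[k _ ->]] kr; exists k.+1%:R^-1.
by rewrite invr_ge0 ler0n invf_le1 ?ltr0n// ler1n.
Qed.

(** Restricted to the moment curve, a nonzero affine map has a coordinate that
    is a nonzero polynomial in t; the product of these finitely many
    polynomials is nonzero and has finitely many roots. The bound on x keeps
    the relevant part of a discrete group finite in later uses. *)
Lemma exists_avoiding_affine (R : realType) n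
    (s : seq ('M[R]_n * 'cV[R]_n)) : (forall p, p \in s -> p <> (0, 0)) ->
  exists x : 'cV[R]_n, (forall i, `|x i 0| <= 1) /\
    forall p, p \in s -> p.1 *m x + p.2 <> 0.
Proof.
move=> s0.
suff [Q Q0 Qs] : exists2 Q : {poly R}, Q != 0 &
    forall t, Q.[t] != 0 -> forall p, p \in s -> p.1 *m moment n t + p.2 <> 0.
  have [t [t0 t1 Qt]] := exists_non_root Q0.
  exists (moment n t); split; last exact: Qs.
  by move=> i; rewrite mxE normrX ger0_norm// exprn_ile1.
elim: s s0 => [|[M c] s IH] s0; first by exists 1 => //; exact: oner_neq0.
have [p ps|Q Q0 Qs] := IH; first by apply: s0; rewrite inE ps orbT.
(* The coefficients of the i-th coordinate of M x + c along the moment curve: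
   c i for degree 0 and M i j for degree j + 1. *)
pose P i : {poly R} := \poly_(k < n.+1)
  (if unlift (ord0 : 'I_n.+1) (inord k) is Some j then M i j else c i 0).
have PE i t : (P i).[t] = (M *m moment n t + c) i 0.
  rewrite horner_poly big_ord_recl inord_val unlift_none expr0 mulr1 !mxE addrC.
  by congr (_ + _); apply: eq_bigr => j _; rewrite inord_val liftK mxE.
have [i Pi0] : exists i, P i != 0.
  apply: contrapT => /forallNP P0.
  have {}P0 i : P i = 0 by apply/eqP/negPn/negP.
  apply: (s0 (M, c)); first by rewrite mem_head.
  congr pair; apply/matrixP => i j; rewrite mxE.
    have /polyP/(_ (lift ord0 j)) := P0 i.
    by rewrite coef_poly ltn_ord inord_val liftK coef0.
  have /polyP/(_ (ord0 : 'I_n.+1)) := P0 i.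
  by rewrite coef_poly ltn_ord inord_val unlift_none coef0 (ord1 j).
exists (P i * Q); first by rewrite mulf_neq0.
move=> t; rewrite hornerM mulf_eq0 negb_or => /andP[Pt Qt] p.
rewrite inE => /predU1P[->/=|]; last exact: Qs.
by move=> e; move: Pt; rewrite PE e mxE eqxx.
Qed.

(** For each pair (k, g), either the two sides of the equation agree at x only
    by accident, which a suitable x avoids, or they agree for all x, and then
    eq_elift applies. *)
Lemma generic_point (R : realType) n (s : seq ('E[R]_(n + 1) * 'E[R]_n))
    (q : R) :
  exists x : 'cV[R]_n, (forall i, `|x i 0| <= 1) /\
    forall k g, (k, g) \in s -> projx (eact k (pt x q)) = eact g x ->
      exists e b, k = elift e b g.
Proof.
pose aff (p : 'E[R]_(n + 1) * 'E[R]_n) : 'M[R]_n * 'cV[R]_n :=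
  (ulsubmx (omx (elin p.1)) - omx (elin p.2),
   projx (evec p.1) + q *: ursubmx (omx (elin p.1)) - evec p.2).
have [p|x [x1 xs]] :=
  @exists_avoiding_affine _ _ [seq aff p | p <- s & aff p != (0, 0)].
  by case/mapP => k; rewrite mem_filter => /andP[/eqP + _] ->.
exists x; split=> // k g kgs kx.
have [/eqP[/eqP + /eqP]|aff0] := boolP (aff (k, g) == (0, 0)).
  by rewrite !subr_eq0 => /eqP ? /eqP; exact: eq_elift.
have /xs[] : aff (k, g) \in [seq aff p | p <- s & aff p != (0, 0)].
  by apply: map_f; rewrite mem_filter aff0.
move: kx; rewrite projx_eact /aff /= /eact mulmxBl => /eqP.
rewrite -subr_eq0 => /eqP <-; rewrite addrACA opprD.
by rewrite (addrC (- evec g)).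
Qed.

(** * Orbits and fibres *)

Section Orbits.
Variables (R : realType) (n : nat) (G : set 'E[R]_(n + 1)).
Hypothesis Gcryst : crystallographic G.

Lemma finite_near (z w : 'cV[R]_(n + 1)) (M : R) :
  finite_set [set k | G k /\ sqn (eact k z - w) <= M].
Proof.
apply: sub_finite_set (finite_euclid_ball Gcryst
  (2 * (2 * M + 2 * sqn w) + 2 * sqn z)) => k [Gk kM]; split=> //.
apply: le_trans (sqn_evec_le k z) _; rewrite lerD2r ler_pM2l//.
rewrite -[eact k z](subrK w).
by apply: le_trans (sqnD_le _ _) _; rewrite lerD2r ler_pM2l.
Qed.

(** The fibres over x and over g x are compared through the orbit of (x, q).
    For this x and each listed g, the group elements that carry (x, q) into the
    segment over g x are only those that cover g. Finiteness holds since such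
    elements have bounded translation part. *)
Lemma generic_orbit (gs : seq 'E[R]_n) (q y0 : R) :
  exists x : 'cV[R]_n, forall g k y, g \in gs -> G k -> 0 <= y <= y0 ->
    eact k (pt x q) = pt (eact g x) y -> exists e b, k = elift e b g.
Proof.
pose Mg : R := \sum_(g <- gs) (2 * sqn (evec g) + 2 * n%:R).
pose M : R := 2 * (Mg + y0 ^+ 2) + 2 * (n%:R + q ^+ 2).
have /finite_seqP[ks ksE] := finite_euclid_ball Gcryst M.
have [x [x1 xs]] := generic_point [seq (k, g) | k <- ks, g <- gs] q.
exists x => g k y ggs Gk /andP[y_ge0 yy0] kx.
apply: xs; last by rewrite kx projx_pt.
apply: allpairs_f => //.
suff : [set` ks] k by [].
rewrite -ksE; split=> //; apply: le_trans (sqn_evec_le k (pt x q)) _.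
rewrite kx !sqn_pt /M lerD// ler_pM2l// lerD//; last exact: sqn_le_coord.
  apply: (@le_trans _ _ (2 * sqn (evec g) + 2 * n%:R)).
    apply: le_trans (sqn_eact_le _ _) _; rewrite lerD2l ler_pM2l//.
    exact: sqn_le_coord.
  rewrite /Mg (big_rem g)//= lerDl sumr_ge0// => h _.
  by rewrite addr_ge0// mulr_ge0 ?sqn_ge0.
by rewrite ler_pXn2r// nnegrE// (le_trans y_ge0).
Qed.

Lemma finite_common_gap (T : choiceType) (F : set T) (P : T -> R -> Prop) :
  finite_set F -> (forall t e e', P t e -> e' <= e -> P t e') ->
  (forall t, F t -> exists2 e, 0 < e & P t e) ->
  exists2 e, 0 < e & forall t, F t -> P t e.
Proof.
move=> /finite_seqP[s ->] Pmono.
elim: s => [|t s IH] sP; first by exists 1.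
have [u us|e e0 es] := IH; first by apply: sP; rewrite /= inE us orbT.
have [d d0 dt] := sP t (mem_head _ _).
exists (Num.min d e) => [|u]; first by rewrite lt_min d0.
rewrite /= inE => /predU1P[->|us].
  by apply: Pmono dt _; rewrite ge_min lexx.
by apply: Pmono (es _ us) _; rewrite ge_min lexx orbT.
Qed.

(** A point of the orbit either lies on the compact segment or has positive
    distance from it, and only finitely many points of the orbit are within
    distance 1. With a = b it says that the orbit is discrete near a point. *)
Lemma orbit_gap (z : 'cV[R]_(n + 1)) (x : 'cV[R]_n) (a b : R) :
  exists2 eps, 0 < eps & forall k y, G k -> a <= y <= b ->
    sqn (eact k z - pt x y) < eps ->
    exists2 y', a <= y' <= b & eact k z = pt x y'.
Proof.
pose P k (eps : R) := forall y, a <= y <= b -> sqn (eact k z - pt x y) < eps ->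
    exists2 y', a <= y' <= b & eact k z = pt x y'.
pose M : R := 2 * 1 + 2 * (a ^+ 2 + b ^+ 2 + 1).
have [eps eps0 epsP] : exists2 eps : R, 0 < eps &
    forall k, [set k | G k /\ sqn (eact k z - pt x 0) <= M] k -> P k eps.
  apply: finite_common_gap; first exact: finite_near.
    by move=> k e e' Pe ee' y yab /lt_le_trans/(_ ee'); exact: Pe.
  move=> k _; rewrite /P; move: (eact k z) => w.
  rewrite (pt_eta w); move: (projx w) (ycoord w) => x' y' {w}.
  have [->|xx'] := eqVneq x' x; last first.
    exists (sqn (x' - x)); first by rewrite lt0r sqn_ge0 sqn_eq0 subr_eq0 xx'.
    move=> y _; rewrite ptB sqn_pt gtrDl => /(le_lt_trans (sqr_ge0 _)).
    by rewrite ltxx.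
  have [y'ab|] := boolP (a <= y' <= b).
    by exists 1 => // y _ _; exists y'.
  rewrite negb_and -!ltNge => /orP[y'a|by'].
    exists ((a - y') ^+ 2); first by rewrite exprn_gt0// subr_gt0.
    by move=> y yab; rewrite ptB sqn_pt subrr sqn0; move: yab; nra.
  exists ((y' - b) ^+ 2); first by rewrite exprn_gt0// subr_gt0.
  by move=> y yab; rewrite ptB sqn_pt subrr sqn0; move: yab; nra.
exists (Num.min eps 1) => [|k y Gk yab]; first by rewrite lt_min eps0 ltr01.
rewrite lt_min => /andP[keps k1]; apply: (epsP k _ y yab keps); split=> //.
apply: le_trans (sqnB_le _ (pt x y) _) _; rewrite /M lerD// ler_pM2l// ?ltW//.
rewrite ptB sqn_pt subrr sqn0 add0r subr0.
by move: yab => /andP[ay yb]; have [y0|/ltW y0] := leP 0 y; nra.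
Qed.

End Orbits.

(** * Continuously differentiable functions *)

(** A first order expansion with quadratic error; it computes derivatives of
    functions that are glued from polynomials without case distinction at the
    gluing point. *)
Lemma is_derive_quadratic (R : realType) (f : R -> R) (t c K : R) :
  (forall r, `|f r - f t - c * (r - t)| <= K * (r - t) ^+ 2) ->
  is_derive t 1 f c.
Proof.
move=> fK.
have cv : h^-1 *: (f (h *: 1 + t) - f t) @[h --> 0^'] --> c.
  apply/cvgrPdist_le => e e0; near=> h.
  have h0 : h != 0 by near: h; exact: nbhs_dnbhs_neq.
  have hK : (`|K| + 1) * `|h| <= e.
    rewrite -ler_pdivlMl ?ltr_wpDl//; near: h; apply: dnbhs0_le.
    by rewrite mulr_gt0// invr_gt0 ltr_wpDl.
  have := fK (h *: 1 + t); rewrite addrK /GRing.scale /= mulr1 => fh.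
  rewrite distrC -(ler_pM2l (_ : 0 < `|h|)) ?normr_gt0// -normrM mulrBr.
  rewrite mulVKf// (mulrC h c); apply: le_trans fh _.
  rewrite -[h ^+ 2]real_normK ?num_real//.
  apply: le_trans (ler_wpM2l (normr_ge0 h) hK).
  by have := ler_norm K; have := sqr_ge0 `|h|; nra.
apply: DeriveDef; first by apply/cvg_ex; exists c.
exact/cvg_lim.
Unshelve. all: by end_near. Qed.

(** A C^1 function on the line that vanishes exactly on the nonpositive reals
    and is piecewise polynomial. *)
Definition relu2 (R : realType) (r : R) : R := Num.max 0 r ^+ 2.

Lemma is_derive_relu2 (R : realType) (t : R) :
  is_derive t 1 (@relu2 R) (2 * Num.max 0 t).
Proof.
apply: (@is_derive_quadratic _ _ _ _ 1) => r; rewrite /relu2 ler_norml.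
have rt := sqr_ge0 (r - t).
by case: (leP 0 r) => r0; case: (leP 0 t) => t0; apply/andP; split; nra.
Qed.

Section ContinuouslyDifferentiable.
Variables (R : realType) (m : nat).
Implicit Types f g h : 'cV[R]_m -> R.

Lemma C1_continuous f : C1 f -> continuous f.
Proof. by move=> [df _] z; exact/differentiable_continuous/df. Qed.

Lemma C1_cst c : C1 (fun _ : 'cV[R]_m => c).
Proof.
split=> [z|v]; first exact: differentiable_cst.
have -> : (fun z : 'cV[R]_m => 'd (fun _ : 'cV[R]_m => c) z v) = cst 0.
  by apply/funext => z; rewrite -[fun _ => c]/(cst c) diff_cst.
exact: cst_continuous.
Qed.

Lemma C1_coord i : C1 (fun z : 'cV[R]_m => z i 0).
Proof.
split=> [z|v]; first exact: differentiable_coord.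
have -> : (fun z : 'cV[R]_m => 'd (fun z : 'cV[R]_m => z i 0) z v) =
    cst (v i 0).
  apply/funext => z.
  pose coord := fun z : 'cV[R]_m => z i 0.
  have coord_lin : linear coord by move=> k a b; rewrite /coord !mxE.
  pose L : {linear _ -> _} :=
    HB.pack coord (GRing.isLinear.Build _ _ _ _ _ coord_lin).
  by rewrite -[fun z => _]/(L : _ -> _) diff_lin//; exact: coord_continuous.
exact: cst_continuous.
Qed.

Lemma C1D f g : C1 f -> C1 g -> C1 (fun z => f z + g z).
Proof.
move=> [df cf] [dg cg]; split=> [z|v]; first exact: differentiableD.
have -> : (fun z => 'd (fun z => f z + g z) z v) =
    (fun z => 'd f z v + 'd g z v).
  by apply/funext => z; exact: (congr1 (@^~ v) (diffD (df z) (dg z))).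
by move=> z; exact: (cvgD (cf v z) (cg v z)).
Qed.

Lemma C1M f g : C1 f -> C1 g -> C1 (fun z => f z * g z).
Proof.
move=> f1 g1; have [df cf] := f1; have [dg cg] := g1.
split=> [z|v]; first exact: differentiableM.
have -> : (fun z => 'd (fun z => f z * g z) z v) =
    (fun z => f z * 'd g z v + g z * 'd f z v).
  by apply/funext => z; exact: (congr1 (@^~ v) (diffM (df z) (dg z))).
move=> z; have fc : continuous_at z f by exact: C1_continuous.
have gc : continuous_at z g by exact: C1_continuous.
exact: (cvgD (cvgM fc (cg v z)) (cvgM gc (cf v z))).
Qed.

Lemma C1_comp (k dk : R -> R) f :
  (forall t : R, is_derive t (1 : R) k (dk t)) ->
  continuous dk -> C1 f -> C1 (fun z => k (f z)).
Proof.
move=> kd dkc f1; have [df cf] := f1.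
have diffk t : differentiable k t by apply/derivable1_diffP; exact: ex_derive.
split=> [z|v]; first exact: differentiable_comp.
have -> : (fun z => 'd (fun z => k (f z)) z v) = (fun z => 'd f z v * dk (f z)).
  apply/funext => z; rewrite -[LHS]/('d (k \o f) z v).
  rewrite (diff_comp (df z) (diffk _)) /= (diff1E (diffk _)) /= derive1E.
  by rewrite (@derive_val _ _ _ _ _ _ _ (kd (f z))).
move=> z; apply: (cvgM (cf v z)).
have fc : continuous_at z f by exact: C1_continuous.
exact: (cvg_comp _ _ fc (dkc (f z))).
Qed.

Lemma C1_sum (I : Type) (r : seq I) (F : I -> 'cV[R]_m -> R) :
  (forall i, C1 (F i)) -> C1 (fun z => \sum_(i <- r) F i z).
Proof.
move=> F1; elim: r => [|i r IH].
  have -> : (fun z => \sum_(i <- [::]) F i z) = (fun=> 0).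
    by apply/funext => z; rewrite big_nil.
  exact: C1_cst.
have -> : (fun z => \sum_(j <- i :: r) F j z) =
    (fun z => F i z + \sum_(j <- r) F j z).
  by apply/funext => z; rewrite big_cons.
exact: (C1D (F1 i) IH).
Qed.

Lemma near_eq_differentiable f h z : (\forall y \near z, f y = h y) ->
  differentiable h z -> differentiable f z.
Proof.
move=> fh dh; have [dc ho] := iffLR (diff_locallyP _ _) dh.
have fz : f z = h z by exact: nbhs_singleton fh.
have fo : f \o shift z = cst (f z) + 'd h z +o_ 0 id.
  apply/eqaddoP => e e0; move/eqaddoP: ho => /(_ e e0) ho.
  have fh0 : \forall y \near (0 : 'cV[R]_m), f (y + z) = h (y + z).
    by move: fh; rewrite (near_shift 0) subr0.
  apply: filterS2 fh0 ho => y fhy; rewrite -fz.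
  rewrite (_ : (f \o shift z - _) y =
    (h \o shift z - (cst (f z) + 'd h z)) y)//=.
  by rewrite /GRing.add /= fhy.
apply/diff_locallyP; rewrite (diff_unique dc fo); split; [exact: dc|exact: fo].
Qed.

(** Functions built below are given by different formulas in different regions;
    near each point one single C^1 formula applies. *)
Lemma C1_local f :
  (forall z : 'cV[R]_m, exists2 h, C1 h & \forall y \near z, f y = h y) ->
  C1 f.
Proof.
move=> floc; split=> [z|v z].
  by have [h [dh _] fh] := floc z; exact: near_eq_differentiable fh (dh z).
have [h [dh ch] fh] := floc z.
rewrite /continuous_at.
have E : \forall y \near z, 'd h y v = 'd f y v.
  have := near_join fh; apply: filterS => y fhy.
  have dfy := near_eq_differentiable fhy (dh y).
  transitivity ('D_v h y); first exact: (esym (deriveE v (dh y))).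
  transitivity ('D_v f y); last exact: (deriveE v dfy).
  by apply/esym; exact: near_eq_derive.
have chz : 'd h y v @[y --> z] --> 'd f z v.
  by rewrite -[X in _ --> X](nbhs_singleton E); exact: (ch v z).
apply: cvg_trans chz; exact: near_eq_cvg E.
Qed.

End ContinuouslyDifferentiable.

Arguments C1_cst {R m} c.
Arguments C1_coord {R m} i.

(** * Invariant functions supported near an orbit *)

Section Bumps.
Variables (R : realType) (m : nat).
Implicit Types (k : 'E[R]_m) (z : 'cV[R]_m).

Lemma C1_eact_coord k i : C1 (fun z => eact k z i 0).
Proof.
have -> : (fun z => eact k z i 0) =
    (fun z => evec k i 0 + \sum_j omx (elin k) i j * z j 0).
  by apply/funext => z; rewrite /eact !mxE.
have C1s : C1 (fun z : 'cV[R]_m => \sum_j omx (elin k) i j * z j 0).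
  by apply: C1_sum => j; exact: (C1M (C1_cst (omx (elin k) i j)) (C1_coord j)).
exact: (C1D (C1_cst (evec k i 0)) C1s).
Qed.

Lemma C1_sqn_eactB k z0 : C1 (fun z => sqn (eact k z - z0)).
Proof.
have -> : (fun z => sqn (eact k z - z0)) =
    (fun z => \sum_i (eact k z i 0 + - z0 i 0) * (eact k z i 0 + - z0 i 0)).
  by apply/funext => z; apply: eq_bigr => i _; rewrite !mxE expr2.
apply: C1_sum => i.
have C1i := C1D (C1_eact_coord k i) (C1_cst (- z0 i 0)).
exact: (C1M C1i C1i).
Qed.

Lemma near_sqnB_lt (z0 : 'cV[R]_m) (eps : R) : 0 < eps ->
  \forall z \near z0, sqn (z - z0) < eps.
Proof.
move=> eps0; have : continuous_at z0 (fun z => sqn (eact 1%g z - z0)).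
  by apply: C1_continuous; exact: C1_sqn_eactB.
move=> /cvgr_lt/(_ eps); rewrite eact1 subrr sqn0 => /(_ eps0).
by apply: filterS => z; rewrite eact1.
Qed.

(** A bump around z0, evaluated after moving z by k; its support is the ball of
    squared radius eps around the preimage of z0 under k. *)
Definition radial_bump (z0 : 'cV[R]_m) (eps : R) k z : R :=
  relu2 (eps - sqn (eact k z - z0)).

Lemma relu2_le0 (r : R) : r <= 0 -> relu2 r = 0.
Proof. by move=> r0; rewrite /relu2 max_l// expr0n. Qed.

Lemma radial_bump_eq0 z0 eps k z :
  eps <= sqn (eact k z - z0) -> radial_bump z0 eps k z = 0.
Proof. by move=> zk; rewrite /radial_bump relu2_le0// subr_le0. Qed.

Lemma C1_radial_bump z0 eps k : C1 (radial_bump z0 eps k).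
Proof.
have C1r : C1 (fun z => eps - sqn (eact k z - z0)).
  have -> : (fun z => eps - sqn (eact k z - z0)) =
      (fun z => eps + (-1) * sqn (eact k z - z0)).
    by apply/funext => z; rewrite mulN1r.
  exact: (C1D (C1_cst eps) (C1M (C1_cst (-1)) (C1_sqn_eactB k z0))).
have cont : continuous (fun t : R => 2 * Num.max 0 t).
  have -> : (fun t : R => 2 * Num.max 0 t) = (fun t => t + `|t|).
    apply/funext => t; case: leP => t0; first by rewrite ger0_norm//; lra.
    by rewrite ltr0_norm//; lra.
  by move=> t; apply: cvgD; [exact: cvg_id|exact: norm_continuous].
exact: (C1_comp (@is_derive_relu2 R) cont C1r).
Qed.

End Bumps.

Section Localization.
Variables (R : realType) (m : nat) (G : set 'E[R]_m).
Hypothesis G_subgroup : subgroup G.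
Variables (z0 : 'cV[R]_m) (eps : R).
Hypothesis eps_gt0 : 0 < eps.
Hypothesis sep : forall k, G k -> sqn (eact k z0 - z0) < 22 * eps ->
  eact k z0 = z0.

(** Transports a function supported near z0 to the whole orbit of z0: near a
    point of the orbit, use any group element k that moves this point close to
    z0. Unlike a sum over the group, this needs no local finiteness argument,
    only that the orbit is separated. The function Phi may depend on k as well,
    so that signs attached to k can be transported too. *)
Definition localize (Phi : 'E[R]_m -> 'cV[R]_m -> R) (z : 'cV[R]_m) : R :=
  if pselect (exists k, G k /\ sqn (eact k z - z0) < eps) is left ex
  then Phi (projT1 (cid ex)) z else 0.

Variable Phi : 'E[R]_m -> 'cV[R]_m -> R.
Hypothesis PhiS : forall k k', G k -> G k' ->
  eact k^-1%g z0 = eact k'^-1%g z0 -> Phi k = Phi k'.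
Hypothesis Phi0 : forall k z, eps <= sqn (eact k z - z0) -> Phi k z = 0.

(** The choice of k is immaterial: two candidates move z to points near z0, so
    they pull z0 back to two orbit points that are close together, hence equal.
    By the weak triangle inequality their distance is controlled by 22 = 2 * 10
    + 2 * 1. *)
Lemma localizeE k z : G k -> sqn (eact k z - z0) < 10 * eps ->
  localize Phi z = Phi k z.
Proof.
have [_ GM GV] := iffLR (subgroupP G) G_subgroup.
move=> Gk kz; rewrite /localize; case: pselect => [ex|nex].
  case: (cid ex) => k' /= [Gk' k'z]; rewrite (PhiS Gk' Gk)//.
  suff E : eact (k' * k^-1)%g z0 = z0 by rewrite -[in LHS]E eactM eactK.
  apply: sep; first exact/GM/GV.
  rewrite eactM sqn_eactV; apply: le_lt_trans (sqnB_le _ z _) _.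
  rewrite (sqnBC _ z) -!sqn_eactV; lra.
by rewrite Phi0// leNgt; apply/negP => zk; apply: nex; exists k.
Qed.

(** Here 10 = 2 * 1 + 2 * 4. *)
Lemma localize_near k z z' : G k -> sqn (eact k z - z0) < 4 * eps ->
  sqn (z' - z) < eps -> localize Phi z' = Phi k z'.
Proof.
move=> Gk kz zz'; apply: localizeE => //.
by apply: le_lt_trans (sqnB_le _ (eact k z) _) _; rewrite sqn_eactB; lra.
Qed.

Lemma localize_out z : (forall k, G k -> eps <= sqn (eact k z - z0)) ->
  localize Phi z = 0.
Proof.
move=> zout; rewrite /localize; case: pselect => // ex; exfalso.
by have [k [Gk]] := ex; rewrite ltNge zout.
Qed.

(** Here 4 = 2 * 1 + 2 * 1. *)
Lemma localize_far z z' : (forall k, G k -> 4 * eps <= sqn (eact k z - z0)) ->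
  sqn (z' - z) < eps -> localize Phi z' = 0.
Proof.
move=> zfar zz'; apply: localize_out => k /zfar kz.
have := sqnB_le (eact k z) (eact k z') z0.
by rewrite sqn_eactB (sqnBC z); lra.
Qed.

Lemma localize_cases z :
  (exists2 k, G k & sqn (eact k z - z0) < 4 * eps) \/
  (forall k, G k -> 4 * eps <= sqn (eact k z - z0)).
Proof.
have [|nex] := pselect (exists2 k, G k & sqn (eact k z - z0) < 4 * eps).
  by left.
by right=> k Gk; rewrite leNgt; apply/negP => kz; apply: nex; exists k.
Qed.

Lemma C1_localize : (forall k, C1 (Phi k)) -> C1 (localize Phi).
Proof.
move=> Phi1; apply: C1_local => z.
have zz' := near_sqnB_lt z eps_gt0.
have [[k Gk kz]|zfar] := localize_cases z.
  by exists (Phi k) => //; apply: filterS zz' => z'; exact: localize_near.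
exists (fun=> 0); first exact: (C1_cst 0).
by apply: filterS zz' => z'; exact: localize_far.
Qed.

Lemma localize_invariant :
  (forall k g z, Phi (k * g)%g (eact g^-1%g z) = Phi k z) ->
  forall g, G g -> forall z, localize Phi (eact g^-1%g z) = localize Phi z.
Proof.
have [_ GM GV] := iffLR (subgroupP G) G_subgroup.
move=> PhiM g Gg z; have [[k Gk kz]|zfar] := localize_cases z.
  have kz10 : sqn (eact k z - z0) < 10 * eps by have := eps_gt0; lra.
  rewrite (localizeE Gk kz10) -(PhiM k g); apply: localizeE; first exact: GM.
  by rewrite eactM eactVK.
have far k : G k -> eps <= sqn (eact k z - z0).
  by move=> Gk; have := zfar k Gk; have := eps_gt0; lra.
rewrite !localize_out// => k Gk.
by have := far _ (GM _ _ Gk (GV _ Gg)); rewrite eactM.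
Qed.

End Localization.

(** If Psi k is a primitive of Phi k along the fibre for each k that matters
    near y, the localized functions inherit this, because near y both are given
    by the same k. *)
Lemma is_derive_localize (R : realType) (n : nat) (G : set 'E[R]_(n + 1))
    (z0 : 'cV[R]_(n + 1)) (eps : R)
    (Phi Psi : 'E[R]_(n + 1) -> 'cV[R]_(n + 1) -> R) (x : 'cV[R]_n) (y : R) :
  subgroup G -> 0 < eps ->
  (forall k, G k -> sqn (eact k z0 - z0) < 22 * eps -> eact k z0 = z0) ->
  (forall k k', G k -> G k' ->
     eact k^-1%g z0 = eact k'^-1%g z0 -> Phi k = Phi k') ->
  (forall k z, eps <= sqn (eact k z - z0) -> Phi k z = 0) ->
  (forall k k', G k -> G k' ->
     eact k^-1%g z0 = eact k'^-1%g z0 -> Psi k = Psi k') ->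
  (forall k z, eps <= sqn (eact k z - z0) -> Psi k z = 0) ->
  (forall k, G k -> sqn (eact k (pt x y) - z0) < 4 * eps ->
     is_derive y (1 : R) (fun t : R => Psi k (pt x t)) (Phi k (pt x y))) ->
  is_derive y (1 : R) (fun t : R => localize G z0 eps Psi (pt x t))
    (localize G z0 eps Phi (pt x y)).
Proof.
move=> Gsub eps0 sep PhiS Phi0 PsiS Psi0 dPsi.
have yy' : \forall t \near y, sqn (pt x t - pt x y) < eps.
  have cvy : t - y @[t --> y] --> y - y by exact: (cvgB cvg_id (cvg_cst y)).
  have cvyy : (t - y) * (t - y) @[t --> y] --> (0 : R).
    by rewrite -[X in _ --> X](mulr0 0) -(subrr y); exact: (cvgM cvy cvy).
  apply: filterS (cvgr_lt _ cvyy _ eps0) => t.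
  by rewrite ptB sqn_pt subrr sqn0 add0r expr2.
have yy : sqn (pt x y - pt x y) < eps by rewrite subrr sqn0.
have [[k Gk ky]|yfar] := localize_cases G z0 eps (pt x y).
  rewrite (localize_near Gsub sep PhiS Phi0 Gk ky yy).
  apply: near_eq_is_derive (dPsi k Gk ky).
  apply: filterS yy' => t yt.
  by rewrite (localize_near Gsub sep PsiS Psi0 Gk ky yt).
rewrite (localize_far _ yfar yy).
apply: near_eq_is_derive (is_derive_cst (0 : R) y (1 : R)).
by apply: filterS yy' => t yt; rewrite (localize_far _ yfar yt).
Qed.

(** * Integrals over segments *)

Section Integrals.
Variable R : realType.
Implicit Types (u F : R -> R) (a b c : R).

Lemma is_derive_continuous F (t d : R) : is_derive t (1 : R) F d ->
  {for t, continuous F}.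
Proof.
move=> dF; apply: differentiable_continuous; apply/derivable1_diffP.
exact: ex_derive.
Qed.

Lemma Rintegral_derive u F a b : a < b -> continuous u ->
  (forall t : R, a <= t <= b -> is_derive t (1 : R) F (u t)) ->
  \int[lebesgue_measure]_(t in `[a, b]) u t = F b - F a.
Proof.
move=> ab cu dF.
have Fc t : a <= t <= b -> {for t, continuous F}.
  by move=> /dF; exact: is_derive_continuous.
rewrite /Rintegral (@continuous_FTC2 _ u F)//.
- exact: continuous_subspaceT.
- split.
  + move=> t; rewrite in_itv /= => /andP[at_ tb].
    have ? : is_derive t (1 : R) F (u t) by apply: dF; rewrite !ltW.
    exact: ex_derive.
  + by apply: cvg_at_right_filter; apply: Fc; rewrite lexx ltW.
  + by apply: cvg_at_left_filter; apply: Fc; rewrite lexx ltW.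
- move=> t; rewrite in_itv /= => /andP[at_ tb]; rewrite derive1E.
  have ? : is_derive t (1 : R) F (u t) by apply: dF; rewrite !ltW.
  exact: derive_val.
Qed.

Lemma antiderivative u a : continuous u ->
  exists F, forall t : R, a < t -> is_derive t (1 : R) F (u t).
Proof.
move=> cu; exists (fun t => \int[lebesgue_measure]_(s in `[a, t]) u s) => t at_.
have tt1 : t < t + 1 by rewrite ltrDl.
have int_u : lebesgue_measure.-integrable `[a, (t + 1)] (EFin \o u).
  apply: continuous_compact_integrable; first exact: segment_compact.
  exact: continuous_subspaceT.
have [|dF F'] := continuous_FTC1 tt1 int_u _ (cu t).
  by rewrite lte_fin.
apply: DeriveDef; first exact: dF.
by rewrite -derive1E; exact: F'.
Qed.

Lemma derive_increment F u a b : a < b ->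
  (forall t : R, a <= t <= b -> is_derive t (1 : R) F (u t)) ->
  exists2 c, a < c < b & F b - F a = u c * (b - a).
Proof.
move=> ab dF; have [||c] := @MVT R F u a b ab.
- by move=> t; rewrite in_itv /= => /andP[at_ tb]; apply: dF; rewrite !ltW.
- apply: derivable_within_continuous => t; rewrite in_itv /= => tab.
  by have ? := dF t tab; exact: ex_derive.
- by rewrite in_itv /=; exists c.
Qed.

(** Nonnegativity makes a primitive nondecreasing; it strictly increases just
    to the right of c. *)
Lemma Rintegral_gt0 u a b c : continuous u -> (forall t, 0 <= u t) ->
  a <= c < b -> 0 < u c -> 0 < \int[lebesgue_measure]_(t in `[a, b]) u t.
Proof.
move=> cu u0 /andP[ac cb] uc.
have ab : a < b by exact: le_lt_trans cb.
have [F dF] := antiderivative (a - 1) cu.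
have {}dF t : a <= t -> is_derive t (1 : R) F (u t).
  by move=> at_; apply: dF; rewrite ltrBlDr; lra.
have dFab t : a <= t <= b -> is_derive t (1 : R) F (u t).
  by move=> /andP[at_ _]; exact: dF.
rewrite (Rintegral_derive ab cu dFab).
have mono s t : a <= s -> s <= t -> F s <= F t.
  move=> as_; rewrite le_eqVlt => /predU1P[->//|st].
  have [r /andP[sr rt]|r _ FE] := @derive_increment F u s t st.
    by apply: dF; exact: le_trans sr.
  by rewrite -subr_ge0 FE mulr_ge0// subr_ge0 ltW.
have /nbhs_ballP[d /= d0 ud] : \forall t \near c, 0 < u t.
  by have := cu c; move=> /cvgr_gt; exact.
(* The positivity of u is known within d of c; e stays in [a, b]. *)
pose e := Num.min (c + d) b.
have ce : c < e by rewrite lt_min cb ltrDl d0.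
have [r /andP[cr re]|r /andP[cr re] FE] := @derive_increment F u c e ce.
  by apply: dF; exact: le_trans cr.
have ur : 0 < u r.
  apply: ud; rewrite /ball /= ltr_distlC.
  move: re; rewrite lt_min => /andP[rd _].
  by rewrite rd andbT; lra.
have : F c < F e by rewrite -subr_gt0 FE mulr_gt0// subr_gt0.
have := mono a c (lexx a) ac.
have eb : e <= b by rewrite ge_min lexx orbT.
have := mono e b (le_trans ac (ltW ce)) eb.
lra.
Qed.

Lemma Rintegral_eq0 u a b : (forall t, a <= t <= b -> u t = 0) ->
  \int[lebesgue_measure]_(t in `[a, b]) u t = 0.
Proof.
move=> u0; rewrite (_ : Rintegral _ _ _ =
  \int[lebesgue_measure]_(t in `[a, b]) (0 : R)).
  by rewrite /Rintegral integral0.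
by apply: eq_Rintegral => t; rewrite inE /= in_itv /= => /u0.
Qed.

Lemma is_derive_affine (s b t : R) :
  is_derive t (1 : R) (fun t : R => b + s * t) s.
Proof.
apply: (@is_derive_quadratic _ _ _ _ 0) => r.
by rewrite (_ : _ - _ - _ = 0) ?normr0 ?mul0r//; ring.
Qed.

(** Change of variables by an isometry of the line, obtained by differentiating
    s * F (b + s * t), which uses s * s = 1. *)
Lemma Rintegral_affine u F (s b y0 : R) : s * s = 1 -> 0 < y0 -> continuous u ->
  (forall t, 0 <= t <= y0 -> is_derive (b + s * t) (1 : R) F (u (b + s * t))) ->
  \int[lebesgue_measure]_(t in `[0, y0]) u (b + s * t) =
  s * (F (b + s * y0) - F b).
Proof.
move=> ss y00 cu dF.
have cus : continuous (fun t => u (b + s * t)).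
  move=> t; apply: (@continuous_comp _ _ _ (fun t => b + s * t) u);
    last exact: cu.
  exact: is_derive_continuous (is_derive_affine s b t).
have dsF t : 0 <= t <= y0 ->
    is_derive t (1 : R) (fun t => s * F (b + s * t)) (u (b + s * t)).
  move=> /dF dFt.
  have dFs :
      is_derive t (1 : R) (F \o (fun t => b + s * t)) (u (b + s * t) * s).
    exact: (@is_derive1_comp _ F (fun t => b + s * t) t _ _ dFt
      (is_derive_affine s b t)).
  have := is_deriveZ s dFs.
  by rewrite /GRing.scale /= mulrCA ss mulr1.
rewrite (Rintegral_derive y00 cus dsF).
by rewrite mulr0 addr0 mulrBr.
Qed.

Lemma Rintegral_reflect u (y0 : R) : 0 < y0 -> continuous u ->
  \int[lebesgue_measure]_(t in `[0, y0]) u (y0 + (-1) * t) =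
  \int[lebesgue_measure]_(t in `[0, y0]) u t.
Proof.
move=> y00 cu; have [F dF] := antiderivative (-1) cu.
have dF1 t : 0 <= t <= y0 -> is_derive t (1 : R) F (u t).
  by move=> /andP[t0 ty0]; apply: dF; lra.
have dF2 t : 0 <= t <= y0 ->
    is_derive (y0 + (-1) * t) (1 : R) F (u (y0 + (-1) * t)).
  by move=> /andP[t0 ty0]; apply: dF; lra.
rewrite (Rintegral_affine _ y00 cu dF2) ?mulrNN ?mulr1//.
rewrite (Rintegral_derive y00 cu dF1).
by rewrite !mulN1r subrr opprB.
Qed.

(** The increment of a primitive over one period is constant, so the integral
    over any interval of length y0 is the same. *)
Lemma Rintegral_periodic u (s b y0 : R) : s = 1 \/ s = -1 -> 0 < y0 ->
  continuous u -> (forall t, u (t + y0) = u t) ->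
  \int[lebesgue_measure]_(t in `[0, y0]) u (b + s * t) =
  \int[lebesgue_measure]_(t in `[0, y0]) u t.
Proof.
move=> s1 y00 cu uper.
(* All intervals of integration lie to the right of a. *)
pose a := - `|b| - y0 - 1.
have [F dF] := antiderivative a cu.
have b1 := ler_norm b; have b2 := ler_norm (- b); rewrite normrN in b2.
have ss : s * s = 1 by case: s1 => ->; lra.
have dF1 t : 0 <= t <= y0 -> is_derive t (1 : R) F (u t).
  by move=> /andP[t0 ty0]; apply: dF; rewrite /a; lra.
have dF2 t : 0 <= t <= y0 -> is_derive (b + s * t) (1 : R) F (u (b + s * t)).
  by move=> /andP[t0 ty0]; apply: dF; rewrite /a; case: s1 => ->; lra.
rewrite (Rintegral_affine ss y00 cu dF2) (Rintegral_derive y00 cu dF1).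
pose P t := F (y0 + 1 * t) - F t.
have dP t : a < t -> is_derive t (1 : R) P ((fun=> 0) t).
  move=> at_; have dFt := dF t at_.
  have dFy : is_derive (y0 + 1 * t) (1 : R) F (u (y0 + 1 * t)).
    by apply: dF; lra.
  have dFc := @is_derive1_comp _ F (fun t => y0 + 1 * t) t _ _ dFy
    (is_derive_affine 1 y0 t).
  have := is_deriveB dFc dFt.
  rewrite (_ : u (y0 + 1 * t) * 1 - u t = 0) //.
  by rewrite mulr1 mul1r (addrC y0) uper subrr.
have Pc' x y : a < x -> x < y -> P y = P x.
  move=> ax xy; have [r ar|r _] := @derive_increment P (fun=> 0) x y xy.
    by apply: dP; move: ar => /andP[xr _]; exact: lt_le_trans xr.
  by rewrite mul0r => /eqP; rewrite subr_eq0 => /eqP.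
have Pc x y : a < x -> a < y -> P x = P y.
  by move=> ax ay; have [/Pc'->|/Pc'->|->] := ltgtP x y.
have P0 : P 0 = F y0 - F 0 by rewrite /P mulr0 addr0.
rewrite -P0; case: s1 => ->.
  by rewrite (Pc 0 b) ?/a; [rewrite /P !mul1r (addrC b)|lra|lra].
rewrite (Pc 0 (b - y0)) ?/a; [|lra|lra].
by rewrite /P !mul1r mulN1r (addrC y0) subrK opprB mulN1r.
Qed.

Lemma is_derive_cube (t : R) :
  is_derive t (1 : R) (fun r => r * relu2 r) (3 * relu2 t).
Proof.
have := is_deriveM (is_derive_id t (1 : R)) (is_derive_relu2 t).
rewrite (_ : _ + _ = 3 * relu2 t)//.
rewrite /GRing.scale /= mulr1 /relu2.
by case: leP => t0; ring.
Qed.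

(** In y, w * (eps - w^2)^2 is the derivative of - (eps - w^2)^3 / 6, up to the
    sign s with which w depends on y. The positive part only enters through
    relu2, so the formula persists across the boundary of the support. *)
Lemma is_derive_bump (eps q b s t : R) : s * s = 1 ->
  let w t := b + s * t - q in
  is_derive t (1 : R)
    (fun t : R => - (s / 6) * ((eps - w t ^+ 2) * relu2 (eps - w t ^+ 2)))
    (w t * relu2 (eps - w t ^+ 2)).
Proof.
move=> ss w.
have dw : is_derive t (1 : R) (fun t => eps - w t ^+ 2) (- (2 * s * w t)).
  apply: (@is_derive_quadratic _ _ _ _ 1) => r.
  rewrite (_ : _ - _ - _ = - (s * s) * (r - t) ^+ 2); last by rewrite /w; ring.
  by rewrite ss mulN1r normrN mul1r normrX real_normK ?num_real.
have := is_deriveZ (- (s / 6)) (@is_derive1_comp _ _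
  (fun t => eps - w t ^+ 2) t _ _ (is_derive_cube _) dw).
rewrite (_ : - (s / 6) *: _ = w t * relu2 (eps - w t ^+ 2))//.
rewrite /GRing.scale /=.
transitivity ((s * s) * (w t * relu2 (eps - w t ^+ 2)));
  last by rewrite ss mul1r.
by field.
Qed.

End Integrals.

Lemma continuous_pt (R : realType) n (x : 'cV[R]_n) (f : 'cV[R]_(n + 1) -> R) :
  continuous f -> continuous (fun y : R => f (pt x y)).
Proof.
move=> cf y; have cpt : {for y, continuous (pt x)}.
  have -> : pt x = (fun y : R => pt x 0 + y *: pt 0 1).
    apply/funext => t; rewrite -{1}(addr0 x) -{1}(add0r t) -ptD; congr (_ + _).
    by rewrite /pt scale_col_mx scaler0 scale_scalar_mx mulr1.
  by apply: cvgD; [exact: cvg_cst|apply: cvgZr_tmp; exact: cvg_id].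
exact: (continuous_comp cpt (cf (pt x y))).
Qed.

(** * Symmetries that come from the group *)

Lemma oextM (R : realType) n e e' (a a' : 'O[R]_n) :
  (oext e a * oext e' a')%g = oext (e (+) e') (a * a')%g.
Proof.
exact: (congr1 (@elin R (n + 1)) (eliftM e 0 (Euclid 0 a) e' 0 (Euclid 0 a'))).
Qed.

Lemma oext1 (R : realType) n : oext false 1%g = 1%g :> 'O[R]_(n + 1).
Proof. exact: (congr1 (@elin R (n + 1)) (elift1 R n)). Qed.

Lemma oextV (R : realType) n e (a : 'O[R]_n) : ((oext e a)^-1 = oext e a^-1)%g.
Proof. exact: (congr1 (@elin R (n + 1)) (eliftV e 0 (Euclid 0 a))). Qed.

Lemma J0E (R : realType) n (J : set 'O[R]_(n + 1)) a :
  J0 J a <-> exists e, J (oext e a).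
Proof.
split=> [[Ja|Ja]|[[] Ja]]; [by exists false|by exists true|by right|by left].
Qed.

Lemma subgroup_J0 (R : realType) n (J : set 'O[R]_(n + 1)) :
  subgroup J -> subgroup (J0 J).
Proof.
move=> /subgroupP[J1 JM JV]; apply/subgroupP; split.
- by apply/J0E; exists false; rewrite oext1.
- move=> a b /J0E[e Ja] /J0E[e' Jb]; apply/J0E; exists (e (+) e').
  by rewrite -oextM; exact: JM.
- by move=> a /J0E[e Ja]; apply/J0E; exists e; rewrite -oextV; exact: JV.
Qed.

Lemma subgroup_point_group (R : realType) m (G : set 'E[R]_m) :
  subgroup G -> subgroup (point_group G).
Proof.
move=> /subgroupP[G1 GM GV]; apply/subgroupP; split.
- by exists 0.
- by move=> a b [v Ga] [w Gb]; eexists; exact: GM Ga Gb.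
- by move=> a [v Ga]; eexists; exact: GV Ga.
Qed.

Lemma subgroup_symmetry_group (R : realType) n (S : set ('cV[R]_n -> R)) :
  subgroup (symmetry_group S).
Proof.
apply/subgroupP; split.
- by move=> f Sf x; rewrite invg1 eact1.
- move=> g h Sg Sh f Sf x; rewrite -(Sg f Sf x) -[RHS](Sh f Sf).
  by rewrite -eactM invgM.
- by move=> g Sg f Sf x; rewrite invgK -[in RHS](eactK g x) Sg.
Qed.

Section Projection.
Variables (R : realType) (n : nat) (G : set 'E[R]_(n + 1)) (y0 : R).
Hypothesis y0_gt0 : 0 < y0.
Implicit Types (g h : 'E[R]_n) (k : 'E[R]_(n + 1)).

Lemma projected_symmetriesP g : projected_symmetries y0 G g <->
  forall f, invariant_functions G f ->
    forall x, projection y0 f (eact g x) = projection y0 f x.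
Proof.
split=> [Sg f Gf x|Sg _ [f Gf <-] x]; last by rewrite -(Sg f Gf) eactVK.
rewrite -[in RHS](eactK g x); apply/esym.
by apply: (Sg (projection y0 f)); exists f.
Qed.

Lemma invariant_eact f k z :
  invariant_functions G f -> G k -> f (eact k z) = f z.
Proof. by move=> [_ Gf] Gk; rewrite -(Gf k Gk) eactK. Qed.

Lemma projection_elift f e b g x : invariant_functions G f -> G (elift e b g) ->
  projection y0 f x =
  \int[lebesgue_measure]_(t in `[0, y0]) f (pt (eact g x) (b + (-1) ^+ e * t)).
Proof.
move=> Gf Gk; apply: eq_Rintegral => t _.
by rewrite -eact_elift invariant_eact.
Qed.

Lemma continuous_fiber f x : invariant_functions G f ->
  continuous (fun t : R => f (pt x t)).
Proof. by move=> [f1 _]; apply: continuous_pt => z; exact: C1_continuous. Qed.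

(** The fibre over x is carried to the fibre over g x at the same height. *)
Lemma projected_symmetry_plus g : G (elift false 0 g) ->
  projected_symmetries y0 G g.
Proof.
move=> Gk; apply/projected_symmetriesP => f Gf x.
have cf : continuous (fun t : R => f (pt (eact g x) t)).
  exact: continuous_fiber.
rewrite (projection_elift x Gf Gk); apply: eq_Rintegral => t _.
by rewrite expr0 mul1r add0r.
Qed.

(** The fibre over x is carried to the fibre over g x with the interval of
    integration reversed. *)
Lemma projected_symmetry_minus g : G (elift true y0 g) ->
  projected_symmetries y0 G g.
Proof.
move=> Gk; apply/projected_symmetriesP => f Gf x.
have cf : continuous (fun t : R => f (pt (eact g x) t)).
  exact: continuous_fiber.
rewrite (projection_elift x Gf Gk) /projection.
rewrite -(Rintegral_reflect y0_gt0 cf).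
by apply: eq_Rintegral => t _; rewrite expr1.
Qed.

(** Invariant functions have period y0 along fibres, so any shift b is
    harmless. *)
Lemma projected_symmetry_periodic e b g : translations G (pt 0 y0) ->
  G (elift e b g) -> projected_symmetries y0 G g.
Proof.
move=> Gy0 Gk; apply/projected_symmetriesP => f Gf x.
have cf : continuous (fun t : R => f (pt (eact g x) t)).
  exact: continuous_fiber.
rewrite (projection_elift x Gf Gk); apply/esym.
apply: (Rintegral_periodic (u := fun t => f (pt (eact g x) t)) b _ y0_gt0
  cf).
  by case: e {Gk}; [right|left].
move=> t; rewrite -(invariant_eact (pt _ t) Gf Gy0).
by rewrite /eact /= mul1mx ptD add0r (addrC y0).
Qed.

End Projection.

(** * Every projected symmetry is covered by a group element *)

Section LiftingSymmetries.
Variables (R : realType) (n : nat) (G : set 'E[R]_(n + 1)) (y0 : R).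
Hypothesis Gcryst : crystallographic G.
Hypothesis y0_gt0 : 0 < y0.
Implicit Types (g h : 'E[R]_n) (k : 'E[R]_(n + 1)).

Let G_subgroup : subgroup G := proj1 Gcryst.
Let G1 : G 1%g. Proof. by have [] := iffLR (subgroupP G) G_subgroup. Qed.
Let GV k : G k -> G k^-1%g.
Proof. by have [_ _ GV] := iffLR (subgroupP G) G_subgroup; exact: GV. Qed.

(** The form of discreteness of the orbit that localization requires. *)
Lemma orbit_separation z : exists2 eps : R, 0 < eps &
  forall k, G k -> sqn (eact k z - z) < 22 * eps -> eact k z = z.
Proof.
have [eps eps0 gap] := orbit_gap Gcryst z (projx z) (ycoord z) (ycoord z).
exists (eps / 22) => [|k Gk]; first by rewrite divr_gt0.
rewrite mulrC divfK ?pnatr_eq0// {2}(pt_eta z) => kz.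
have [|y' /andP[y1 y2] ->] := gap k (ycoord z) Gk _ kz; first by rewrite lexx.
by rewrite [RHS]pt_eta (@le_anti _ _ y' (ycoord z)) // y1 y2.
Qed.

(** A nonnegative invariant bump on the orbit of (x, y0 / 2) has positive
    projection at x, hence also at g x. Therefore the orbit meets the segment
    over g x: otherwise the bump could be chosen so small that it vanishes
    there. For generic x the group element responsible for this covers g. *)
Lemma projected_symmetry_lift g : projected_symmetries y0 G g ->
  exists e b, G (elift e b g).
Proof.
move=> /projected_symmetriesP Sg.
have [x xgen] := generic_orbit Gcryst [:: g] (y0 / 2) y0.
set z := pt x (y0 / 2).
suff [k [y [Gk yI kz]]] : exists k y,
    [/\ G k, 0 <= y <= y0 & eact k z = pt (eact g x) y].
  have [|e [b kE]] := xgen g k y _ Gk yI kz; first by rewrite mem_head.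
  by exists e, b; rewrite -kE.
apply: contrapT => nomeet.
have [e1 e10 sep] := orbit_separation z.
have [e2 e20 gap] := orbit_gap Gcryst z (eact g x) 0 y0.
pose eps := Num.min e1 e2.
have eps0 : 0 < eps by rewrite lt_min e10.
have sepe k : G k -> sqn (eact k z - z) < 22 * eps -> eact k z = z.
  move=> Gk kz; apply: sep => //; apply: lt_le_trans kz _.
  by rewrite ler_pM2l// ge_min lexx.
have bumpS k k' : G k -> G k' -> eact k^-1%g z = eact k'^-1%g z ->
    radial_bump z eps k = radial_bump z eps k'.
  move=> _ _ kk'; apply/funext => w.
  by rewrite /radial_bump (sqn_eact_sub k) (sqn_eact_sub k') kk'.
pose f := localize G z eps (radial_bump z eps).
have Gf : invariant_functions G f.
  split.
    apply: C1_localize => // *; first exact: radial_bump_eq0.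
    exact: C1_radial_bump.
  apply: localize_invariant => // [*|k h w]; first exact: radial_bump_eq0.
  by rewrite /radial_bump eactM eactVK.
have f0 w : 0 <= f w.
  by rewrite /f /localize; case: pselect => // ?; exact: sqr_ge0.
have fz : 0 < f z.
  rewrite /f (localizeE G_subgroup sepe bumpS (@radial_bump_eq0 _ _ _ _) G1).
    by rewrite /radial_bump eact1 subrr sqn0 subr0 exprn_gt0// lt_max eps0 orbT.
  by rewrite eact1 subrr sqn0 mulr_gt0.
have : 0 < projection y0 f x.
  have cf : continuous (fun t : R => f (pt x t)).
    exact: (continuous_fiber Gf).
  apply: (Rintegral_gt0 cf _ _ fz); first by move=> t; exact: f0.
  by apply/andP; split; have := y0_gt0; lra.
rewrite -(Sg f Gf) /projection Rintegral_eq0 ?ltxx// => t tI.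
apply: localize_out => k Gk; rewrite leNgt; apply/negP => kt; apply: nomeet.
rewrite sqn_eact_sub in kt.
have [|y yI kE] := gap k^-1%g t (GV Gk) tI.
  by apply: lt_le_trans kt _; rewrite ge_min lexx orbT.
by exists k^-1%g, y; split => //; exact: GV.
Qed.

End LiftingSymmetries.

(** * A test function that sees only the endpoints *)

Section EndpointTest.
Variables (R : realType) (n : nat) (G : set 'E[R]_(n + 1)).
Hypothesis G_subgroup : subgroup G.
Variables (x : 'cV[R]_n) (q eps : R).
Let z := pt x q.
Hypothesis eps_gt0 : 0 < eps.
Hypothesis stab : forall k, G k -> eact k z = z -> k = 1%g.
Hypothesis sep : forall k, G k -> sqn (eact k z - z) < 22 * eps -> eact k z = z.
Implicit Types (k : 'E[R]_(n + 1)) (h : 'E[R]_n).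

Let G1 : G 1%g. Proof. by have [] := iffLR (subgroupP G) G_subgroup. Qed.
Let GM k k' : G k -> G k' -> G (k * k')%g.
Proof. by have [_ GM _] := iffLR (subgroupP G) G_subgroup; exact: GM. Qed.
Let GV k : G k -> G k^-1%g.
Proof. by have [_ _ GV] := iffLR (subgroupP G) G_subgroup; exact: GV. Qed.

(** The sign (-1)^e when k covers an isometry of the base, see yslopeE. *)
Definition yslope k : R := omx (elin k) (rshift n ord0) (rshift n ord0).

(** Antisymmetric in the height around q: along a fibre, a full copy of it
    inside the interval of integration contributes nothing. *)
Definition odd_bump k (w : 'cV[R]_(n + 1)) : R :=
  (ycoord (eact k w) - q) * radial_bump z eps k w.

(** The primitive of odd_bump along fibres; its sign depends on whether k
    preserves the orientation of the fibre. *)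
Definition primitive_bump k (w : 'cV[R]_(n + 1)) : R :=
  - (yslope k / 6) * ((eps - sqn (eact k w - z)) * radial_bump z eps k w).

(* Only a trivial stabilizer makes an antisymmetric bump, or a sign attached
   to k, compatible with transport along the orbit. *)
Let stabS (Phi : 'E[R]_(n + 1) -> 'cV[R]_(n + 1) -> R) k k' :
  G k -> G k' -> eact k^-1%g z = eact k'^-1%g z -> Phi k = Phi k'.
Proof.
move=> Gk Gk' kk'; congr Phi; apply: divg1_eq; apply: stab; first exact/GM/GV.
by rewrite eactM -kk' eactVK.
Qed.

Lemma odd_bump_eq0 k w : eps <= sqn (eact k w - z) -> odd_bump k w = 0.
Proof. by move=> kw; rewrite /odd_bump radial_bump_eq0 ?mulr0. Qed.

Lemma primitive_bump_eq0 k w :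
  eps <= sqn (eact k w - z) -> primitive_bump k w = 0.
Proof. by move=> kw; rewrite /primitive_bump radial_bump_eq0 ?mulr0. Qed.

Lemma C1_odd_bump k : C1 (odd_bump k).
Proof.
have -> : odd_bump k =
    (fun w => (eact k w (rshift n ord0) 0 + - q) * radial_bump z eps k w).
  by apply/funext => w; rewrite /odd_bump /ycoord mxE.
exact: (C1M (C1D (C1_eact_coord k (rshift n ord0)) (C1_cst (- q)))
  (C1_radial_bump z eps k)).
Qed.

Lemma invariant_odd_bump : invariant_functions G (localize G z eps odd_bump).
Proof.
split.
  apply: C1_localize => //.
  - exact: stabS.
  - exact: odd_bump_eq0.
  - exact: C1_odd_bump.
apply: localize_invariant => // [||k h w]; [exact: stabS|exact: odd_bump_eq0|].
by rewrite /odd_bump /radial_bump eactM eactVK.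
Qed.

Lemma yslopeE e b h : yslope (elift e b h) = (-1) ^+ e.
Proof.
by rewrite /yslope omx_elift block_mxEdr mxE eqxx mulr1n.
Qed.

Lemma eact_fiber k e b h t : k^-1%g = elift e b h ->
  eact k (pt (eact h x) t) = pt x (- ((-1) ^+ e * b) + (-1) ^+ e * t).
Proof.
by move=> kV; rewrite -(invgK k) kV eliftV eact_elift eactK.
Qed.

Lemma odd_bump_fiber k e b h t : k^-1%g = elift e b h ->
  let w := - ((-1) ^+ e * b) + (-1) ^+ e * t - q in
  odd_bump k (pt (eact h x) t) = w * relu2 (eps - w ^+ 2).
Proof.
move=> kV w; rewrite /odd_bump /radial_bump (eact_fiber t kV) ycoord_pt ptB.
by rewrite sqn_pt subrr sqn0 add0r.
Qed.

Lemma primitive_bump_fiber k e b h t : k^-1%g = elift e b h ->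
  let w := - ((-1) ^+ e * b) + (-1) ^+ e * t - q in
  primitive_bump k (pt (eact h x) t) =
    - ((-1) ^+ e / 6) * ((eps - w ^+ 2) * relu2 (eps - w ^+ 2)).
Proof.
move=> kV w; rewrite /primitive_bump /radial_bump (eact_fiber t kV) ptB.
by rewrite sqn_pt subrr sqn0 add0r -(invgK k) kV eliftV yslopeE.
Qed.

(** By the fundamental theorem of calculus the projection only depends on the
    two endpoints of the segment. *)
Lemma projection_odd_bump (y0 : R) h : 0 < y0 ->
  (forall k y, G k -> 0 <= y <= y0 ->
     sqn (eact k (pt (eact h x) y) - z) < 4 * eps ->
     exists e b, k^-1%g = elift e b h) ->
  let P y := localize G z eps primitive_bump (pt (eact h x) y) in
  projection y0 (localize G z eps odd_bump) (eact h x) = P y0 - P 0.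
Proof.
move=> y00 lift P.
have cf : continuous (fun t : R => localize G z eps odd_bump (pt (eact h x) t)).
  exact: (continuous_fiber invariant_odd_bump).
have dP y : 0 <= y <= y0 ->
    is_derive y (1 : R) P (localize G z eps odd_bump (pt (eact h x) y)).
  move=> yI; apply: (is_derive_localize G_subgroup eps_gt0 sep (@stabS odd_bump)
    odd_bump_eq0 (@stabS primitive_bump) primitive_bump_eq0).
  move=> k Gk kn; have [e [b kV]] := lift k y Gk yI kn.
  rewrite (odd_bump_fiber y kV).
  have -> : (fun t : R => primitive_bump k (pt (eact h x) t)) = (fun t : R =>
      - ((-1) ^+ e / 6) *
      ((eps - (- ((-1) ^+ e * b) + (-1) ^+ e * t - q) ^+ 2) *
        relu2 (eps - (- ((-1) ^+ e * b) + (-1) ^+ e * t - q) ^+ 2))).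
    by apply/funext => t; rewrite (primitive_bump_fiber t kV).
  by apply: is_derive_bump; rewrite -signr_addb addbb.
exact: (Rintegral_derive y00 cf dP).
Qed.

Lemma localize_primitive_cases w :
  localize G z eps primitive_bump w = 0 \/
  exists k, [/\ G k, sqn (eact k w - z) < eps &
    localize G z eps primitive_bump w = primitive_bump k w].
Proof.
have [[k [Gk kw]]|nk] := pselect (exists k, G k /\ sqn (eact k w - z) < eps).
  right; exists k; split => //; apply: (localizeE G_subgroup sep) => //.
  - exact: stabS.
  - exact: primitive_bump_eq0.
  - by have := eps_gt0; lra.
left; apply: localize_out => k Gk; rewrite leNgt; apply/negP => kw.
by apply: nk; exists k.
Qed.

Lemma localize_primitive_center :
  localize G z eps primitive_bump z = - (eps * eps ^+ 2 / 6).
Proof.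
have z1 : sqn (eact 1%g z - z) < 10 * eps.
  by rewrite eact1 subrr sqn0; have := eps_gt0; lra.
have S k k' : G k -> G k' -> eact k^-1%g z = eact k'^-1%g z ->
    primitive_bump k = primitive_bump k' by exact: stabS.
rewrite (localizeE G_subgroup sep S primitive_bump_eq0 G1 z1).
rewrite /primitive_bump /radial_bump eact1 subrr sqn0 subr0 -elift1 yslopeE.
by rewrite /relu2 max_r ?ltW// expr0; field.
Qed.

End EndpointTest.

(** * Reflections in the endpoints *)

Lemma cube_ge0 (R : realType) (r : R) : 0 <= r * relu2 r.
Proof.
rewrite /relu2; case: (leP 0 r) => r0; last by rewrite expr0n mulr0.
by rewrite mulr_ge0// exprn_ge0.
Qed.

Lemma cube_lt (R : realType) (r eps : R) :
  0 < eps -> r < eps -> r * relu2 r < eps * eps ^+ 2.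
Proof.
move=> e0 re; rewrite /relu2; case: (leP 0 r) => r0; last first.
  by rewrite expr0n mulr0 mulr_gt0// exprn_gt0.
by rewrite -!exprS ltrXn2r.
Qed.

Lemma sixth_pos_gt (R : realType) (E c : R) :
  0 < E -> 0 <= c -> - (E / 6) < - (-1 / 6) * c.
Proof. lra. Qed.

Lemma sixth_pos_ge (R : realType) (c : R) : 0 <= c -> 0 <= - (-1 / 6) * c.
Proof. lra. Qed.

Lemma sixth_neg_gt (R : realType) (E c : R) :
  c < E -> - (E / 6) < - (1 / 6) * c.
Proof. lra. Qed.

Lemma sixth_neg_le (R : realType) (c : R) : 0 <= c -> - (1 / 6) * c <= 0.
Proof. lra. Qed.

Lemma lt_mul4 (R : realType) (r eps : R) : 0 < eps -> r < eps -> r < 4 * eps.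
Proof. lra. Qed.

(** Suppose the reflection y |-> 2 q - y of the fibres is not in G, so that (x,
    q) has trivial stabilizer for generic x, and compare the odd bump at the
    endpoint q over x and over g x. By projection_odd_bump the difference P h
    q' - P h q of the endpoint values, where q' is the other endpoint, is the
    same for h = 1 and h = g. Over x it is positive: P takes its least value at
    the point (x, q) itself, and not at (x, q'), since translation by y0 is not
    in G. Over g x it is not positive: if P g q < 0 or P g q' > 0, the element
    of G responsible for it would cover g and either fix all heights or
    exchange the endpoints. *)
Lemma endpoint_reflection (R : realType) (n : nat) (G : set 'E[R]_(n + 1))
    (y0 : R) (g : 'E[R]_n) (q : R) :
  crystallographic G -> 0 < y0 -> q = 0 \/ q = y0 ->
  projected_symmetries y0 G g ->
  ~ G (elift false y0 1%g) -> ~ G (elift false 0 g) -> ~ G (elift true y0 g) ->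
  G (elift true (2 * q) 1%g).
Proof.
move=> Gcryst y0_gt0 qend /projected_symmetriesP Sg ny0 nplus nminus.
have G_subgroup : subgroup G := proj1 Gcryst.
have [G1 GM GV] := iffLR (subgroupP G) G_subgroup.
apply: contrapT => nrefl.
pose q' := y0 - q.
have qI : 0 <= q <= y0 by case: qend => ->; rewrite lexx ltW.
have q'I : 0 <= q' <= y0 by rewrite /q'; move: qI; lra.
have [x xgen] := generic_orbit Gcryst [:: 1%g; g] q y0.
have gen1 k y : G k -> 0 <= y <= y0 -> eact k (pt x q) = pt (eact 1%g x) y ->
    exists e b, k = elift e b 1%g.
  by move=> Gk yI; apply: xgen => //; rewrite inE eqxx.
have geng k y : G k -> 0 <= y <= y0 -> eact k (pt x q) = pt (eact g x) y ->
    exists e b, k = elift e b g.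
  by move=> Gk yI; apply: xgen => //; rewrite !inE eqxx orbT.
have stab k : G k -> eact k (pt x q) = pt x q -> k = 1%g.
  move=> Gk kz; have [|[] [b kE]] := gen1 k q Gk qI; first by rewrite eact1.
    move: kz Gk; rewrite kE eact_elift eact1 => /pt_inj[_ bq] Gk; exfalso.
    by apply: nrefl; rewrite (_ : 2 * q = b)//; move: bq; rewrite expr1; lra.
  move: kz; rewrite kE eact_elift eact1 expr0 => /pt_inj[_ bq].
  by rewrite -elift1; congr elift; lra.
have [e1 e10 sep1] := orbit_separation Gcryst (pt x q).
have [e2 e20 gap2] := orbit_gap Gcryst (pt x q) (eact 1%g x) 0 y0.
have [e3 e30 gap3] := orbit_gap Gcryst (pt x q) (eact g x) 0 y0.
have [e4 e40 gap4] := orbit_gap Gcryst (pt x q) (eact g x) q q.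
have [e5 e50 gap5] := orbit_gap Gcryst (pt x q) (eact g x) q' q'.
(* One radius below all the gaps; the factor 4 is that of localize_near. *)
have [eps eps0 [le1 le2 le3 le4 le5]] : exists2 eps : R, 0 < eps &
    [/\ eps <= e1, 4 * eps <= e2, 4 * eps <= e3, eps <= e4 & eps <= e5].
  exists (Num.min e1 (Num.min (e2 / 4) (Num.min (e3 / 4) (Num.min e4 e5)))).
    by rewrite !lt_min e10 e40 e50 !divr_gt0.
  split.
  - by rewrite ge_min lexx.
  - by rewrite mulrC -ler_pdivlMr// !ge_min lexx ?orbT.
  - by rewrite mulrC -ler_pdivlMr// !ge_min lexx ?orbT.
  - by rewrite !ge_min lexx ?orbT.
  - by rewrite !ge_min lexx ?orbT.
have sep k : G k -> sqn (eact k (pt x q) - pt x q) < 22 * eps ->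
    eact k (pt x q) = pt x q.
  by move=> Gk kz; apply: sep1 => //; lra.
have near1 k y : G k -> 0 <= y <= y0 ->
    sqn (eact k (pt (eact 1%g x) y) - pt x q) < 4 * eps ->
    exists e b, k^-1%g = elift e b 1%g.
  move=> Gk yI; rewrite sqn_eact_sub => ky.
  have [|y' y'I kE] := gap2 k^-1%g y (GV _ Gk) yI; first exact: lt_le_trans le2.
  exact: gen1 (GV _ Gk) y'I kE.
have nearg k y : G k -> 0 <= y <= y0 ->
    sqn (eact k (pt (eact g x) y) - pt x q) < 4 * eps ->
    exists e b, k^-1%g = elift e b g.
  move=> Gk yI; rewrite sqn_eact_sub => ky.
  have [|y' y'I kE] := gap3 k^-1%g y (GV _ Gk) yI; first exact: lt_le_trans le3.
  exact: geng (GV _ Gk) y'I kE.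
pose f := localize G (pt x q) eps (odd_bump x q eps).
have Gf : invariant_functions G f.
  exact: (invariant_odd_bump G_subgroup eps0 stab sep).
(* P h y is the value of the primitive at height y over h x. *)
have [P [Pg P1 P1q cases]] : exists P : 'E[R]_n -> R -> R,
    [/\ projection y0 f (eact g x) = P g y0 - P g 0,
        projection y0 f (eact 1%g x) = P 1%g y0 - P 1%g 0,
        P 1%g q = - (eps * eps ^+ 2 / 6) &
        forall h y, P h y = 0 \/ exists k,
          [/\ G k, sqn (eact k (pt (eact h x) y) - pt x q) < eps &
              P h y = primitive_bump x q eps k (pt (eact h x) y)]].
  exists (fun h y =>
    localize G (pt x q) eps (primitive_bump x q eps) (pt (eact h x) y)).
  split.
  - exact: (projection_odd_bump G_subgroup eps0 stab sep y0_gt0 nearg).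
  - exact: (projection_odd_bump G_subgroup eps0 stab sep y0_gt0 near1).
  - rewrite eact1.
    exact: (localize_primitive_center G_subgroup eps0 stab sep).
  - by move=> h y; exact: (localize_primitive_cases G_subgroup eps0 stab sep).
have Peq : P g q' - P g q = P 1%g q' - P 1%g q.
  have PE : P g y0 - P g 0 = P 1%g y0 - P 1%g 0.
    by rewrite -Pg -P1 eact1; exact: (Sg _ Gf x).
  rewrite /q'; case: qend => ->; rewrite ?subr0 ?subrr; first exact: PE.
  by rewrite -opprB PE opprB.
have P1q' : - (eps * eps ^+ 2 / 6) < P 1%g q'.
  have e3_gt0 : 0 < eps * eps ^+ 2 by rewrite mulr_gt0// exprn_gt0.
  have [->|[k [Gk kq' ->]]] := cases 1%g q'.
    by rewrite oppr_lt0 divr_gt0.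
  have [[] [b kV]] := near1 k q' Gk q'I (lt_mul4 eps0 kq').
    rewrite (primitive_bump_fiber _ _ _ q' kV) expr1.
    exact: sixth_pos_gt e3_gt0 (cube_ge0 _).
  rewrite (primitive_bump_fiber _ _ _ q' kV) expr0.
  apply: sixth_neg_gt; apply: cube_lt => //.
  rewrite gtrBl exprn_even_gt0//=; apply/eqP => bq.
  have {}bq : b = y0 - 2 * q by move: bq; rewrite /q'; clear; lra.
  have Gb := GV _ Gk; rewrite kV bq in Gb.
  apply: ny0; case: qend => qE; first by move: Gb; rewrite qE mulr0 subr0.
  have := GV _ Gb; rewrite eliftV expr0 mul1r invg1 qE.
  by rewrite (_ : - (y0 - 2 * y0) = y0)//; clear; lra.
have Pgq : 0 <= P g q.
  have [->//|[k [Gk kq ->]]] := cases g q.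
  have [e [b kV]] := nearg k q Gk qI (lt_mul4 eps0 kq).
  rewrite (primitive_bump_fiber _ _ _ q kV).
  rewrite sqn_eact_sub in kq.
  have [||y /andP[y1 y2] kE] := gap4 k^-1%g q (GV _ Gk); rewrite ?lexx//.
    exact: lt_le_trans le4.
  have yq : y = q by apply: le_anti; rewrite y1 y2.
  move: kE; rewrite kV yq eact_elift => /pt_inj[_ bq].
  case: e kV bq => kV bq; last first.
    case: nplus; have := GV _ Gk; rewrite kV (_ : b = 0)//.
    by move: bq; rewrite expr0; clear; lra.
  by rewrite expr1; exact: sixth_pos_ge (cube_ge0 _).
have Pgq' : P g q' <= 0.
  have [->//|[k [Gk kq' ->]]] := cases g q'.
  have [e [b kV]] := nearg k q' Gk q'I (lt_mul4 eps0 kq').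
  rewrite (primitive_bump_fiber _ _ _ q' kV).
  rewrite sqn_eact_sub in kq'.
  have [||y /andP[y1 y2] kE] := gap5 k^-1%g q' (GV _ Gk); rewrite ?lexx//.
    exact: lt_le_trans le5.
  have yq : y = q' by apply: le_anti; rewrite y1 y2.
  move: kE; rewrite kV yq eact_elift => /pt_inj[_ bq].
  case: e kV bq => kV bq.
    case: nminus; have := GV _ Gk; rewrite kV (_ : b = y0)//.
    by move: bq; rewrite expr1 /q'; clear; lra.
  by rewrite expr0; exact: sixth_neg_le (cube_ge0 _).
move: Peq P1q P1q' Pgq Pgq'; clear; lra.
Qed.

(** * Vertical translations *)

Lemma exists_min_seq (R : realType) (s : seq R) (x : R) :
  exists2 m, m \in x :: s & forall y, y \in x :: s -> m <= y.
Proof.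
elim: s x => [|a s IH] x.
  by exists x; rewrite ?mem_head// => y; rewrite inE => /eqP->.
have [m ms mmin] := IH a.
exists (Num.min x m).
  by rewrite /Num.min; case: ifP => _; rewrite inE ?eqxx// ms orbT.
move=> y; rewrite inE => /predU1P[->|/mmin]; rewrite ge_min ?lexx// => ->.
by rewrite orbT.
Qed.

(** A discrete subgroup of the line consists of the integer multiples of its
    least positive element t. Halves of such multiples lie in t Z or in t Z + t
    / 2; the element c is of the second kind, so b or b - c is of the first. *)
Lemma discrete_subgroup_half (R : realType) (A : set R) (b c : R) :
  (forall x y, A x -> A y -> A (x - y)) ->
  finite_set [set a | A a /\ 0 < a <= 2 * c] -> 0 < c ->
  A (2 * b) -> A (2 * c) -> ~ A c -> A b \/ A (b - c).
Proof.
move=> AB /finite_seqP[s sE] c0 A2b A2c nAc.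
have A0 : A 0 by rewrite -(subrr (2 * c)); exact: AB.
have AN x : A x -> A (- x) by rewrite -sub0r; exact: AB.
have AD x y : A x -> A y -> A (x + y).
  by move=> Ax /AN; rewrite -{2}(opprK y); exact: AB.
have [t ts tmin] := exists_min_seq s (2 * c).
have sP a : a \in s -> A a /\ 0 < a <= 2 * c.
  by move=> as_; have : [set` s] a by []; rewrite -sE.
have [At t0 t2c] : [/\ A t, 0 < t & t <= 2 * c].
  move: ts; rewrite inE => /predU1P[->|/sP[At /andP[t0 t2c]]]; last by [].
  by rewrite mulr_gt0.
have {}tmin a : A a -> 0 < a -> t <= a.
  move=> Aa a0; have [a2c|/ltW] := leP a (2 * c); last exact: le_trans.
  apply: tmin; rewrite inE; apply/orP; right.
  by have : [set a | A a /\ 0 < a <= 2 * c] a; [rewrite /= a0|rewrite sE].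
have Amul (k : int) : A (t *~ k).
  case: k => k; rewrite ?NegzE ?mulrNz; last apply: AN.
    by elim: k => [|k IH]; rewrite -?pmulrn ?mulr0n// mulrS; apply: AD.
  rewrite -pmulrn; elim: k => [|k IH]; first by rewrite mulr1n.
  by rewrite mulrS; apply: AD.
have Agen a : A a -> exists k : int, a = t *~ k.
  move=> Aa; exists (Num.floor (a / t)); apply/eqP; rewrite -subr_eq0.
  have Ar : A (a - t *~ Num.floor (a / t)) by exact: AB.
  have /andP[r0 r1] : 0 <= a - t *~ Num.floor (a / t) < t.
    have := floor_itv (a / t).
    rewrite ler_pdivlMr// ltr_pdivrMr// => /andP[f1 f2].
    rewrite subr_ge0 ltrBlDr -mulrzr mulrC f1 /=.
    by move: f2; rewrite rmorphD mulrDl mul1r addrC.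
  move: r0; rewrite le_eqVlt => /predU1P[<-//|r0].
  by have := tmin _ Ar r0; rewrite leNgt r1.
have half a : A (2 * a) -> exists k : int, a = t *~ k \/ a = t *~ k + t / 2.
  move=> /Agen[k ak]; exists (divz k 2).
  have a2 : a = (k%:~R / 2) * t by move: ak; rewrite -mulrzr; clear; lra.
  have := divz_eq k 2; have := modz_ge0 k (isT : 2 != 0 :> int).
  have := ltz_pmod k (isT : 0 < 2 :> int).
  case: (modz k 2) => [[|[|m]]|m] // _ _ kE; [left|right].
    by rewrite a2 {1}kE addr0 rmorphM /= -mulrzr; field.
  by rewrite a2 {1}kE rmorphD rmorphM /= -mulrzr; field.
have [i [cE|cE]] := half c A2c; first by case: nAc; rewrite cE.
have [j [bE|bE]] := half b A2b; [left|right]; first by rewrite bE.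
by rewrite bE cE opprD addrACA subrr addr0 -mulrzBr.
Qed.

Lemma finite_fiber_translations (R : realType) n (G : set 'E[R]_(n + 1))
    (M : R) :
  crystallographic G ->
  finite_set [set a : R | G (elift false a 1%g) /\ 0 < a <= M].
Proof.
move=> Gcryst.
pose f (a : R) : 'E[R]_(n + 1) := elift false a 1%g.
have finj : {in f @^-1` [set k | G k /\ sqn (evec k) <= M ^+ 2] &, injective f}.
  by move=> a b _ _ /(congr1 (@evec _ _)) /pt_inj[].
apply: sub_finite_set
  (finite_preimage finj (finite_euclid_ball Gcryst (M ^+ 2))).
move=> a [Ga /andP[a0 aM]]; split=> //.
rewrite [evec _]/(pt 0 a) sqn_pt sqn0 add0r ler_pXn2r// nnegrE ltW//.
exact: lt_le_trans aM.
Qed.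

(** If neither element is in G, endpoint_reflection gives the fibre reflections
    at both endpoints, so the vertical translations contain 2 y0. An element of
    G covering g, of height b, conjugates the reflection at 0 to the one at b,
    so they also contain 2 b. As y0 itself is not a translation, b or b - y0
    is, and composing with it and with the reflection at 0 produces one of the
    two elements after all. *)
Lemma projected_symmetry_endpoints (R : realType) n (G : set 'E[R]_(n + 1))
    (y0 : R) (g : 'E[R]_n) :
  crystallographic G -> 0 < y0 -> ~ G (elift false y0 1%g) ->
  projected_symmetries y0 G g -> G (elift false 0 g) \/ G (elift true y0 g).
Proof.
move=> Gcryst y0_gt0 ny0 Sg.
have [_ GM GV] := iffLR (subgroupP G) (proj1 Gcryst).
apply: contrapT => /not_orP[nplus nminus].
have Grefl : G (elift true 0 1%g).
  rewrite -(mulr0 2).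
  by apply: endpoint_reflection Gcryst y0_gt0 _ Sg ny0 nplus nminus; left.
have G2y0 : G (elift false (2 * y0) 1%g).
  have Gr : G (elift true (2 * y0) 1%g).
    by apply: endpoint_reflection Gcryst y0_gt0 _ Sg ny0 nplus nminus; right.
  by have := GM _ _ Gr Grefl; rewrite eliftM mulr0 addr0 mulg1.
have [b Gb] : exists b, G (elift false b g).
  have [[] [b Gb]] := projected_symmetry_lift Gcryst y0_gt0 Sg;
    last by exists b.
  by exists b; have := GM _ _ Gb Grefl; rewrite eliftM mulr0 addr0 mulg1.
have G2b : G (elift false (2 * b) 1%g).
  have := GM _ _ (GM _ _ (GM _ _ Gb Grefl) (GV _ Gb)) Grefl.
  rewrite eliftV !eliftM !mulg1 mulgV /= !(mulr0, addr0, expr0, expr1, mul1r).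
  by rewrite mulN1r opprK (mulr_natl b 2).
have Gsub x y : G (elift false x 1%g) -> G (elift false y 1%g) ->
    G (elift false (x - y) 1%g).
  move=> Gx Gy; have := GM _ _ Gx (GV _ Gy).
  by rewrite eliftV eliftM /= !expr0 !mul1r mulgV.
have := discrete_subgroup_half (A := fun a => G (elift false a 1%g)) Gsub
  (finite_fiber_translations (2 * y0) Gcryst) y0_gt0 G2b G2y0 ny0.
case=> Ga; have := GM _ _ (GV _ Ga) Gb.
  rewrite eliftV eliftM /= !expr0 !mul1r addNr invg1 mul1g; exact: nplus.
rewrite eliftV eliftM /= !expr0 !mul1r invg1 mul1g opprB subrK => Gy0.
by apply: nminus; have := GM _ _ Gy0 Grefl; rewrite eliftM mulr0 addr0 mulg1.
Qed.

(** * The point group of the projected symmetries *)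

Theorem proposition5p1 (R : realType) (n : nat) (Gamma : set 'E[R]_(n + 1))
    (y0 : R)
    (L := translations Gamma) (J := point_group Gamma)
    (Gamma' := projected_symmetries y0 Gamma) (J' := point_group Gamma') :
  (1 <= n)%N -> crystallographic Gamma -> 0 < y0 ->
  [/\ subgroup (J0 J), subgroup J' & J' `<=` J0 J] /\
  (L (pt 0 y0) -> J' = J0 J) /\
  (~ L (pt 0 y0) ->
     J' = [set a | J0 J a /\
            exists v : 'cV[R]_n, Gamma (Euclid (pt v 0) (oplus a)) \/
                                 Gamma (Euclid (pt v y0) (ominus a))]) /\
  (forall (a : 'O[R]_n) (v : 'cV[R]_n), J' a -> Gamma' (Euclid v a) ->
     (exists2 w, Gamma (Euclid w (oplus a)) & v = projx w) \/
     (exists2 w, Gamma (Euclid w (ominus a)) & v = projx w)).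
Proof.
move=> _ Gcryst y0_gt0; have Gsub := proj1 Gcryst.
have J'J0 : J' `<=` J0 J.
  move=> a [v Sv]; have [e [b Gk]] := projected_symmetry_lift Gcryst y0_gt0 Sv.
  by apply/J0E; exists e, (pt v b).
have LE : L (pt 0 y0) = Gamma (elift false y0 1%g).
  by rewrite /L /translations /elift oext1.
split; [split=> //|split; [|split]].
- exact/subgroup_J0/subgroup_point_group.
- exact/subgroup_point_group/subgroup_symmetry_group.
- move=> Ly0; apply/seteqP; split=> // a /J0E[e [w Gw]]; exists (projx w).
  apply: (projected_symmetry_periodic y0_gt0 Ly0 (e := e) (b := ycoord w)).
  by rewrite /elift /= -pt_eta.
- rewrite LE => ny0; apply/seteqP; split=> a.
    move=> J'a; split; first exact: J'J0.
    have [v Sv] := J'a; exists v.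
    exact: (projected_symmetry_endpoints Gcryst y0_gt0 ny0 Sv).
  move=> [_ [v Gv]]; exists v; case: Gv => Gv.
    exact: projected_symmetry_plus.
  exact: projected_symmetry_minus.
- move=> a v _ Sv; have [e [b Gk]] := projected_symmetry_lift Gcryst y0_gt0 Sv.
  by case: e Gk => Gk; [right|left]; exists (pt v b); rewrite ?projx_pt.
Qed.
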